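(* Let $\mathbb{K}$ be a field of characteristic zero, $S=\mathbb{K}[x_1,x_2,x_3,x_4]$ with the standard grading, and $I\subset S$ a homogeneous ideal containing no nonzero linear form such that $A=S/I$ is an Artinian Gorenstein algebra with $H$-vector $(1,4,4,4,4,1)$. Then the nonzero graded Betti numbers $b_{i,j}$ of $A$ over $S$ are exactly $$b_{0,0}=1,\quad b_{1,2}=6,\quad b_{2,3}=8,\quad b_{3,4}=3,\quad b_{1,5}=3,\quad b_{2,6}=8,\quad b_{3,7}=6,\quad b_{4,9}=1,$$ and all other $b_{i,j}$ are zero.
   Context: The $H$-vector of an Artinian graded algebra $A=S/I$ is $(1,h_1,\dots,h_s)$, where $h_i=\dim_{\mathbb{K}}A_i$ and $s$ is the socle degree, i.e. the largest $i$ with $A_i\neq 0$. The graded Betti numbers $b_{i,j}$ of $A$ are defined by the minimal graded free resolution of $A$ over $S$, whose $i$-th module is $F_i\simeq\bigoplus_j S(-j)^{b_{i,j}}$; equivalently $b_{i,j}=\dim_{\mathbb{K}}\operatorname{Tor}_i^S(A,\mathbb{K})_j$. *)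

(* Defs.v *)
From HB Require Import structures.
From mathcomp Require Export all_boot all_order all_algebra.
From mathcomp.multinomials Require Export mpoly.

Set Implicit Arguments.
Unset Strict Implicit.
Unset Printing Implicit Defensive.

Import GRing.Theory.
Local Open Scope ring_scope.

(* The quotient S/I is not built as a type: I is an arbitrary Prop-valued
   subset of S = {mpoly K[n]}, and statements about S/I are statements about
   representatives modulo I. *)

Definition is_ideal (n : nat) (K : fieldType) (I : {mpoly K[n]} -> Prop) : Prop :=
  [/\ I 0,
      (forall p q, I p -> I q -> I (p + q)) &
      (forall a p, I p -> I (a * p))].

Definition is_homog_ideal (n : nat) (K : fieldType)
    (I : {mpoly K[n]} -> Prop) : Prop :=
  is_ideal I /\ forall p (d : nat), I p -> I (pihomog mdeg d p).

(* The image of the subspace V in S/I has a K-basis with r elements. *)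
Definition has_dim_mod (n : nat) (K : fieldType)
    (V I : {mpoly K[n]} -> Prop) (r : nat) : Prop :=
  exists e : 'I_r -> {mpoly K[n]},
    [/\ (forall k, V (e k)),
        (forall c : 'I_r -> K, I (\sum_k c k *: e k) -> forall k, c k = 0) &
        (forall p, V p -> exists c : 'I_r -> K, I (p - \sum_k c k *: e k))].

(* The Hilbert function of S/I is h followed by zeros; the last entry of h is
   required to be nonzero so that (size h).-1 is the largest degree in which
   S/I is nonzero. *)
Definition has_H_vector (n : nat) (K : fieldType)
    (I : {mpoly K[n]} -> Prop) (h : seq nat) : Prop :=
  last 0%N h != 0%N /\
  forall d : nat, has_dim_mod (fun p => p \is d.-homog) I (nth 0%N h d).

(* Descending chain condition; ideals of S/I are the ideals of S containing I. *)
Definition quotient_artinian (n : nat) (K : fieldType)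
    (I : {mpoly K[n]} -> Prop) : Prop :=
  forall J : nat -> {mpoly K[n]} -> Prop,
    (forall k, is_ideal (J k)) ->
    (forall k p, I p -> J k p) ->
    (forall k p, J k.+1 p -> J k p) ->
    exists N, forall k, (N <= k)%N -> forall p, J N p -> J k p.

(* Representatives of the socle (0 : (x_1, ..., x_n)) of S/I. *)
Definition in_socle (n : nat) (K : fieldType)
    (I : {mpoly K[n]} -> Prop) (p : {mpoly K[n]}) : Prop :=
  forall k : 'I_n, I ('X_k * p).

Definition quotient_artinian_gorenstein (n : nat) (K : fieldType)
    (I : {mpoly K[n]} -> Prop) : Prop :=
  quotient_artinian I /\ has_dim_mod (in_socle I) I 1.

(* Homogeneous of integer degree d; for d < 0 this forces p = 0. *)
Definition zhomog (n : nat) (K : fieldType) (d : int) (p : {mpoly K[n]}) : Prop :=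
  forall m, m \in msupp p -> (mdeg m)%:Z = d.

(* A sequence ... -> F_1 -> F_0 -> S/I with
   F_i = \bigoplus_(k < gf_rank i) S(- gf_deg i k).
   Elements of F_i are row vectors and maps act by right multiplication;
   gf_aug lists representatives in S of the images in S/I of the basis of F_0. *)
Record gfree_seq (n : nat) (K : fieldType) := GFreeSeq {
  gf_rank : nat -> nat;
  gf_deg : forall i : nat, 'I_(gf_rank i) -> int;
  gf_aug : 'cV[{mpoly K[n]}]_(gf_rank 0);
  gf_diff : forall i : nat, 'M[{mpoly K[n]}]_(gf_rank i.+1, gf_rank i)
}.

Definition gf_graded (n : nat) (K : fieldType) (F : gfree_seq n K) : Prop :=
  (forall k, zhomog (gf_deg k) (gf_aug F k 0)) /\
  (forall i a b, zhomog (gf_deg a - gf_deg b) (gf_diff F i a b)).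

Definition gf_resolves (n : nat) (K : fieldType)
    (I : {mpoly K[n]} -> Prop) (F : gfree_seq n K) : Prop :=
  [/\ (forall p, exists v : 'rV_(gf_rank F 0), I (p - (v *m gf_aug F) 0 0)),
      (forall v : 'rV_(gf_rank F 0),
         I ((v *m gf_aug F) 0 0) <-> exists w, v = w *m gf_diff F 0) &
      (forall i (v : 'rV_(gf_rank F i.+1)),
         v *m gf_diff F i = 0 <-> exists w, v = w *m gf_diff F i.+1)].

(* The image of F_(i+1) lies in (x_1, ..., x_n) F_i: every matrix entry has
   zero constant term. *)
Definition gf_minimal (n : nat) (K : fieldType) (F : gfree_seq n K) : Prop :=
  forall i a b, (gf_diff F i a b)@_0%MM = 0.

Definition minimal_graded_free_resolution (n : nat) (K : fieldType)
    (I : {mpoly K[n]} -> Prop) (F : gfree_seq n K) : Prop :=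
  [/\ gf_graded F, gf_resolves I F & gf_minimal F].

Definition gf_betti (n : nat) (K : fieldType) (F : gfree_seq n K)
    (i : nat) (j : int) : nat :=
  #|[set k : 'I_(gf_rank F i) | gf_deg k == j]|.

(* b is the family of graded Betti numbers of S/I: a minimal graded free
   resolution exists, and every such resolution has
   F_i = \bigoplus_j S(-j)^(b i j). *)
Definition has_graded_betti (n : nat) (K : fieldType)
    (I : {mpoly K[n]} -> Prop) (b : nat -> int -> nat) : Prop :=
  (exists F, minimal_graded_free_resolution I F) /\
  (forall F, minimal_graded_free_resolution I F ->
     forall i j, gf_betti F i j = b i j).

(* The family whose nonzero values are the entries (i, j, b_ij) of t. *)
Definition betti_table (t : seq (nat * int * nat)) (i : nat) (j : int) : nat :=
  (\sum_(e <- t | e.1 == (i, j)) e.2)%N.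

(* Main.v *)
From HB Require Import structures.
Require Import Defs.
From mathcomp Require Import ring zify.
From Stdlib Require Import Classical ClassicalEpsilon.

Set Implicit Arguments.
Unset Strict Implicit.
Unset Printing Implicit Defensive.

Import GRing.Theory.
Local Open Scope ring_scope.

(* Let M_i be the matrix of multiplication by x_i on a K-basis of A = S/I.  The
   Koszul complex of the commuting operators x_i - M_i on the free module with
   that basis resolves A: in characteristic zero the derivations d/dx_i provide
   the homotopy.  Cancelling unit entries turns it into a minimal resolution, and
   comparing it with any minimal resolution gives
   b_{i,j} = dim H_i(x_1, ..., x_n; A)_j.
     Let A be Gorenstein with H-vector (1, n, ..., n, 1) and socle degree s > n,
   s > 2.  A linear form acts as zero on Koszul homology.  A generic linear form
   is injective on A_1: otherwise, for some y in a finite set whose n-th powers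
   span the products of n linear forms, every x + t y would kill an element of
   A_1 not killed by y^n, which is impossible for n + 1 values of t.  By
   dimensions it is then bijective from A_d to A_(d+1) for 1 <= d <= s - 2, so
   H_i vanishes in internal degree i + d for 2 <= d <= s - 2.  The absence of
   linear forms in I, the one-dimensional socle and the pairing
   A_(s-1) x A_1 -> A_s give enough other vanishing for the ranks of the Koszul
   differentials to be determined by the dimensions of the complex. *)

(** * Homogeneous parts and ideals *)

Section HomogeneousParts.
Variables (n : nat) (K : fieldType).
Implicit Types (p q : {mpoly K[n]}) (d e : int).

Lemma mcoeff_pihomog (k : nat) p m :
  (pihomog mdeg k p)@_m = p@_m *+ (mdeg m == k).
Proof.
have [<-|mk] := eqVneq (mdeg m) k; last first.
  by rewrite (dhomog_nemf_coeff (pihomogP mdeg k p)).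
have p_le : (mmeasure mdeg p <= (mdeg m).+1 + msize p)%N by rewrite leq_addl.
rewrite mulr1n [in RHS](pihomog_partitionE p_le) [RHS]raddf_sum /=.
rewrite (bigD1 (Ordinal (leq_addr (msize p) (mdeg m).+1))) //= big1 ?addr0 //.
move=> d; rewrite -val_eqE eq_sym /= => md.
by rewrite (dhomog_nemf_coeff (pihomogP mdeg d p)).
Qed.

Lemma zhomogP d p : zhomog d p <-> forall m, (mdeg m)%:Z != d -> p@_m = 0.
Proof.
split=> homp m => [md|].
  by apply: memN_msupp_eq0; apply: contra md => /homp ->.
by rewrite mcoeff_msupp => /eqP pm; apply/eqP; apply: contra_notT pm => /homp.
Qed.

Definition zpart d p : {mpoly K[n]} :=
  if d is Posz k then pihomog mdeg k p else 0.

Lemma mcoeff_zpart d p m : (zpart d p)@_m = p@_m *+ ((mdeg m)%:Z == d).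
Proof. by case: d => k /=; [rewrite mcoeff_pihomog | rewrite mcoeff0]. Qed.

Lemma zpart_is_linear d : linear (zpart d).
Proof. by case: d => k a p q /=; rewrite ?linearP // scaler0 addr0. Qed.

HB.instance Definition _ d :=
  GRing.isLinear.Build K {mpoly K[n]} {mpoly K[n]} _ (zpart d)
    (zpart_is_linear d).

Lemma zpart_homog d p : zhomog d (zpart d p).
Proof. by apply/zhomogP=> m /negbTE md; rewrite mcoeff_zpart md. Qed.

Lemma zpart_idP d p : zhomog d p <-> zpart d p = p.
Proof.
split=> [/zhomogP homp|<-]; last exact: zpart_homog.
apply/mpolyP=> m; rewrite mcoeff_zpart.
by case: eqVneq => [//|/homp ->].
Qed.

Lemma zhomog0 d : zhomog d (0 : {mpoly K[n]}).
Proof. by move=> m; rewrite msupp0. Qed.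

Lemma zhomogB d p q : zhomog d p -> zhomog d q -> zhomog d (p - q).
Proof.
move=> /zpart_idP homp /zpart_idP homq; apply/zpart_idP.
by rewrite raddfB /= homp homq.
Qed.

Lemma zhomogMz d p (z : int) : zhomog d p -> zhomog d (p *~ z).
Proof. by move=> /zpart_idP homp; apply/zpart_idP; rewrite raddfMz /= homp. Qed.

Lemma zhomog_sum (T : Type) (r : seq T) (P : pred T) (G : T -> {mpoly K[n]}) d :
  (forall t, P t -> zhomog d (G t)) -> zhomog d (\sum_(t <- r | P t) G t).
Proof.
move=> homG; apply/zpart_idP; rewrite raddf_sum.
by apply: eq_bigr => t /homG/zpart_idP.
Qed.

Lemma zpartMr d e p q : zhomog e q -> zpart (d + e) (p * q) = zpart d p * q.
Proof.
move=> /zhomogP homq; apply/mpolyP=> m.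
rewrite mcoeff_zpart !mcoeffM -sumrMnl.
apply: eq_bigr => -[k l] /= /eqP/(congr1 mdeg); rewrite mdegD => m_kl.
rewrite mcoeff_zpart.
have [deg_l|/homq ->] := eqVneq (mdeg (val l))%:Z e; last first.
  by rewrite !mulr0 mul0rn.
rewrite mulrnAl -[in RHS](inj_eq (addIr e)).
by rewrite -[in X in _ = _ *+ (X == _)]deg_l -PoszD -m_kl.
Qed.

Lemma zhomogM d e p q : zhomog d p -> zhomog e q -> zhomog (d + e) (p * q).
Proof.
by move=> /zpart_idP homp homq; apply/zpart_idP; rewrite zpartMr // homp.
Qed.

Lemma zhomog_dhomog (d : nat) p : zhomog d%:Z p <-> p \is d.-homog.
Proof.
split=> [homp|/dhomogP homp m /homp /= -> //].
by apply/dhomogP=> m /homp [].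
Qed.

Lemma zpart_dhomog d (k : nat) p :
  p \is k.-homog -> zpart d p = p *+ (k%:Z == d).
Proof.
move=> homp; apply/mpolyP=> m; rewrite mcoeff_zpart mcoeffMn.
have [->//|mk] := eqVneq (mdeg m) k.
by rewrite (dhomog_nemf_coeff homp) // !mul0rn.
Qed.

Lemma zhomogC (c : K) : zhomog 0 (c%:MP_[n]).
Proof.
apply/zhomogP=> m; rewrite mcoeffC eqz_nat mdeg_eq0 => /negbTE ->.
by rewrite mulr0.
Qed.

Lemma zhomogX i : zhomog 1 ('X_i : {mpoly K[n]}).
Proof. by apply/(zhomog_dhomog 1); rewrite dhomogX /= mdeg1. Qed.

Lemma dhomogXM i (d : nat) p : p \is d.-homog -> 'X_i * p \is d.+1.-homog.
Proof. by move=> homp; rewrite -add1n dhomogM // dhomogX /= mdeg1. Qed.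

Lemma zhomog_const p : zhomog 0 p -> p = (p@_0)%:MP.
Proof.
move/zhomogP=> homp; apply/mpolyP=> m; rewrite mcoeffC.
have [->|m0] := eqVneq m 0%MM; first by rewrite mulr1.
by rewrite mulr0 homp //; rewrite -mdeg_eq0 in m0.
Qed.

Lemma zhomog_mcoeff0 d p : zhomog d p -> p@_0%MM != 0 -> d = 0.
Proof. by move=> homp; rewrite -mcoeff_msupp => /homp; rewrite mdeg0. Qed.

End HomogeneousParts.

Arguments zpart : simpl never.

Section Ideals.
Variables (n : nat) (K : fieldType) (I : {mpoly K[n]} -> Prop).
Hypothesis idI : is_ideal I.
Implicit Types (p q : {mpoly K[n]}).

Lemma ideal0 : I 0. Proof. by case: idI. Qed.

Lemma idealD p q : I p -> I q -> I (p + q).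
Proof. by case: idI => _ ID _; apply: ID. Qed.

Lemma idealMl a p : I p -> I (a * p).
Proof. by case: idI => _ _ IM; apply: IM. Qed.

Lemma idealZ c p : I p -> I (c *: p).
Proof. by move=> /(idealMl c%:MP); rewrite mul_mpolyC. Qed.

Lemma idealMz p (z : int) : I p -> I (p *~ z).
Proof. by move=> /(idealMl z%:~R); rewrite mulrzl. Qed.

Lemma idealN p : I p -> I (- p).
Proof. by move=> /(idealMl (-1)); rewrite mulN1r. Qed.

Lemma idealB p q : I p -> I q -> I (p - q).
Proof. by move=> Ip /idealN; apply: idealD. Qed.

Lemma ideal_sum (T : Type) (r : seq T) (P : pred T) (G : T -> {mpoly K[n]}) :
  (forall t, P t -> I (G t)) -> I (\sum_(t <- r | P t) G t).
Proof.
by move=> IG; elim/big_ind: _ => //; [exact: ideal0 | exact: idealD].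
Qed.

Lemma ideal_subr_trans p q : I (p - q) -> I q -> I p.
Proof. by move=> Ipq Iq; rewrite -(subrK q p); apply: idealD. Qed.

Lemma idealZ_inj (c : K) p : c != 0 -> I (c *: p) -> I p.
Proof. by move=> c0 /(idealZ c^-1); rewrite scalerA mulVf // scale1r. Qed.

Definition ideal_mx m r (A : 'M[{mpoly K[n]}]_(m, r)) : Prop :=
  forall a b, I (A a b).

Lemma ideal_mxD m r (A B : 'M_(m, r)) :
  ideal_mx A -> ideal_mx B -> ideal_mx (A + B).
Proof. by move=> IA IB a b; rewrite mxE; apply: idealD. Qed.

Lemma ideal_mxN m r (A : 'M_(m, r)) : ideal_mx A -> ideal_mx (- A).
Proof. by move=> IA a b; rewrite mxE; apply: idealN. Qed.

Lemma ideal_mxB m r (A B : 'M_(m, r)) :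
  ideal_mx A -> ideal_mx B -> ideal_mx (A - B).
Proof. by move=> IA /ideal_mxN; apply: ideal_mxD. Qed.

Lemma ideal_mulmx m r s (A : 'M_(m, r)) (B : 'M_(r, s)) :
  ideal_mx B -> ideal_mx (A *m B).
Proof.
by move=> IB a b; rewrite mxE; apply: ideal_sum => k _; apply: idealMl.
Qed.

End Ideals.

Lemma homog_ideal_zpart n (K : fieldType) (I : {mpoly K[n]} -> Prop) d p :
  is_homog_ideal I -> I p -> I (zpart d p).
Proof.
by move=> [idI homI] Ip; case: d => k; [apply: homI | apply: ideal0].
Qed.

(** * Comparison of graded free resolutions *)

Section GradedMatrices.
Variables (n : nat) (K : fieldType).
Local Notation S := {mpoly K[n]}.

Section Degrees.
Variables (m q : nat) (dA : 'I_m -> int) (dB : 'I_q -> int).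

Definition graded_mx (M : 'M[S]_(m, q)) : Prop :=
  forall a b, zhomog (dA a - dB b) (M a b).

Definition graded_mx_part (M : 'M[S]_(m, q)) : 'M[S]_(m, q) :=
  \matrix_(a, b) zpart (dA a - dB b) (M a b).

Definition deg_preserving (M : 'M[K]_(m, q)) : Prop :=
  forall a b, M a b != 0 -> dA a = dB b.

Definition coef0_mx (M : 'M[S]_(m, q)) : 'M[K]_(m, q) :=
  map_mx (mcoeff 0%MM) M.

Lemma graded_mx_partP M : graded_mx (graded_mx_part M).
Proof. by move=> a b; rewrite mxE; apply: zpart_homog. Qed.

Lemma graded_mx_part_id M : graded_mx M -> graded_mx_part M = M.
Proof.
by move=> gM; apply/matrixP=> a b; rewrite mxE; apply/zpart_idP.
Qed.

Lemma graded_mxB M N : graded_mx M -> graded_mx N -> graded_mx (M - N).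
Proof. by move=> gM gN a b; rewrite !mxE; apply: zhomogB. Qed.

Lemma graded_mx_coef0 M : graded_mx M -> deg_preserving (coef0_mx M).
Proof.
by move=> gM a b; rewrite mxE => /(zhomog_mcoeff0 (gM a b))/subr0_eq.
Qed.

End Degrees.

Lemma graded_mx_partM m q r (dA : 'I_m -> int) (dB : 'I_q -> int)
    (dC : 'I_r -> int) (M : 'M_(m, q)) (N : 'M_(q, r)) :
  graded_mx dB dC N ->
  graded_mx_part dA dC (M *m N) = graded_mx_part dA dB M *m N.
Proof.
move=> gN; apply/matrixP=> a c; rewrite !mxE raddf_sum /=.
apply: eq_bigr => b _; rewrite mxE.
by rewrite -(zpartMr _ _ (gN b c)) addrA subrK.
Qed.

Lemma graded_mxM m q r (dA : 'I_m -> int) (dB : 'I_q -> int)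
    (dC : 'I_r -> int) (M : 'M_(m, q)) (N : 'M_(q, r)) :
  graded_mx dA dB M -> graded_mx dB dC N -> graded_mx dA dC (M *m N).
Proof.
move=> gM gN; rewrite -(graded_mx_part_id gM) -(graded_mx_partM dA M gN).
exact: graded_mx_partP.
Qed.

Lemma graded_mx1 m (dA : 'I_m -> int) : graded_mx dA dA 1%:M.
Proof.
move=> a b; rewrite mxE; have [->|_] := eqVneq a b; last exact: zhomog0.
by rewrite subrr -mpolyC1; apply: zhomogC.
Qed.

Lemma graded_mx_lift m q r (dA : 'I_m -> int) (dB : 'I_q -> int)
    (dC : 'I_r -> int) (V : 'M_(m, r)) (D : 'M_(q, r)) :
  graded_mx dA dC V -> graded_mx dB dC D ->
  (forall a, exists w, row a V = w *m D) ->
  exists2 W, graded_mx dA dB W & V = W *m D.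
Proof.
move=> gV gD /fin_all_exists [w rowV].
have VE : V = (\matrix_a w a) *m D.
  by apply/row_matrixP=> a; rewrite row_mul rowK rowV.
exists (graded_mx_part dA dB (\matrix_a w a)); first exact: graded_mx_partP.
by rewrite -(graded_mx_partM _ _ gD) -VE graded_mx_part_id.
Qed.

Lemma coef0_mxM m q r (M : 'M[S]_(m, q)) (N : 'M[S]_(q, r)) :
  coef0_mx (M *m N) = coef0_mx M *m coef0_mx N.
Proof. exact: map_mxM. Qed.

End GradedMatrices.

Section Comparison.
Variables (n : nat) (K : fieldType) (I : {mpoly K[n]} -> Prop).
Hypothesis homI : is_homog_ideal I.
Implicit Types F G H : gfree_seq n K.
Local Notation S := {mpoly K[n]}.
Local Notation deg G i := (@gf_deg n K G i).

Let idI : is_ideal I := homI.1.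

(* The outgoing differential of F_i, with zero target for i = 0; the map
   F_0 -> S/I is not part of it. *)
Definition gf_out_rank G i := if i is i'.+1 then gf_rank G i' else 0%N.

Definition gf_out_deg G i : 'I_(gf_out_rank G i) -> int :=
  if i is i'.+1 then deg G i' else fun=> 0.

Definition gf_out G i : 'M[S]_(gf_rank G i, gf_out_rank G i) :=
  if i is i'.+1 then gf_diff G i' else 0.

Definition gf_cycle G i m : 'M[S]_(m, gf_rank G i) -> Prop :=
  if i is i'.+1 then fun V => V *m gf_diff G i' = 0
  else fun V => ideal_mx I (V *m gf_aug G).

Definition chain_map F G (f : forall i, 'M[S]_(gf_rank F i, gf_rank G i)) :=
  [/\ forall i, graded_mx (deg F i) (deg G i) (f i),
      ideal_mx I (gf_aug F - f 0%N *m gf_aug G) &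
      forall i, gf_diff F i *m f i = f i.+1 *m gf_diff G i].

Lemma gf_cycle_diff G i : gf_resolves I G -> gf_cycle (gf_diff G i).
Proof.
case=> _ exact0 exactS; case: i => [|i] /=.
  move=> a b; rewrite (ord1 b); have /exact0 : exists w,
      row a (gf_diff G 0) = w *m gf_diff G 0.
    by exists (delta_mx 0 a); rewrite -rowE.
  by rewrite -row_mul mxE.
apply/row_matrixP=> a; rewrite row_mul row0; apply/exactS.
by exists (delta_mx 0 a); rewrite -rowE.
Qed.

Lemma gf_cycle_lift G i m (dA : 'I_m -> int) (V : 'M_(m, gf_rank G i)) :
  gf_graded G -> gf_resolves I G -> graded_mx dA (deg G i) V -> gf_cycle V ->
  exists2 W, graded_mx dA (deg G i.+1) W & V = W *m gf_diff G i.
Proof.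
move=> [_ gG] [_ exact0 exactS] gV cycV; apply: graded_mx_lift gV _ _ => // a.
case: i V cycV => [|i] V cycV.
  by apply/exact0; rewrite -row_mul mxE; apply: cycV.
by apply/exactS; rewrite -row_mul [_ *m _]cycV row0.
Qed.

Lemma augmentation_lift F G :
  gf_graded F -> gf_graded G -> gf_resolves I G ->
  exists2 f, graded_mx (deg F 0) (deg G 0) f &
    ideal_mx I (gf_aug F - f *m gf_aug G).
Proof.
move=> [gF _] [gG _] [surjG _ _].
have /fin_all_exists [v v_lift] : forall a, exists v : 'rV_(gf_rank G 0),
    I (gf_aug F a 0 - (v *m gf_aug G) 0 0) by move=> a; apply: surjG.
exists (graded_mx_part (deg F 0) (deg G 0) (\matrix_a v a)).
  exact: graded_mx_partP.
move=> a b; rewrite (ord1 b).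
have := homog_ideal_zpart (gf_deg a) homI (v_lift a).
rewrite raddfB /= ((zpart_idP _ _).1 (gF a)) !mxE raddf_sum; congr (I (_ - _)).
by apply: eq_bigr => c _; rewrite !mxE -(zpartMr _ _ (gG c)) subrK.
Qed.

Lemma chain_map_exists F G :
  gf_graded F -> gf_resolves I F -> gf_graded G -> gf_resolves I G ->
  exists f, @chain_map F G f.
Proof.
move=> gF rF gG rG; have [f0 gf0 augf0] := augmentation_lift gF gG rG.
pose stage i := {f : 'M[S]_(gf_rank F i, gf_rank G i) |
  graded_mx (deg F i) (deg G i) f /\ gf_cycle (gf_diff F i *m f)}.
have cyc0 : gf_cycle (gf_diff F 0 *m f0).
  rewrite /= -mulmxA -[f0 *m _](subKr (gf_aug F)) mulmxBr.
  by apply: (ideal_mxB idI); [apply: (gf_cycle_diff 0) | apply: ideal_mulmx].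
have step i (f : stage i) :
    {g : stage i.+1 | gf_diff F i *m sval f = sval g *m gf_diff G i}.
  apply: constructive_indefinite_description; case: f => f [gf cycf] /=.
  have [g gg fg] := gf_cycle_lift gG rG (graded_mxM (gF.2 i) gf) cycf.
  suff cycg : gf_cycle (gf_diff F i.+1 *m g).
    by exists (exist _ g (conj gg cycg)).
  rewrite /= -mulmxA -fg mulmxA [_ *m gf_diff F i](gf_cycle_diff i.+1 rF).
  exact: mul0mx.
pose fix seq_map i : stage i :=
  if i is i'.+1 then sval (step i' (seq_map i'))
  else exist _ f0 (conj gf0 cyc0).
exists (fun i => sval (seq_map i)); split=> // i.
  by case: (svalP (seq_map i)).
exact: (svalP (step i (seq_map i))).
Qed.

Lemma chain_map_id F : chain_map (fun i => 1%:M : 'M_(gf_rank F i)).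
Proof.
split=> [i||i]; [exact: graded_mx1 | | by rewrite mul1mx mulmx1].
by rewrite mul1mx subrr => a b; rewrite mxE; apply: ideal0.
Qed.

Lemma chain_map_comp F G H f g :
  @chain_map F G f -> @chain_map G H g -> chain_map (fun i => f i *m g i).
Proof.
move=> [gf augf cf] [gg augg cg]; split=> [i||i].
- exact: graded_mxM (gf i) (gg i).
- rewrite -mulmxA -[g 0%N *m _](subKr (gf_aug G)) mulmxBr opprB addrA addrAC.
  by apply: (ideal_mxD idI) => //; apply: ideal_mulmx.
- by rewrite mulmxA cf -!mulmxA cg.
Qed.

Lemma chain_map_homotopy F G f g :
  gf_graded F -> gf_resolves I F -> gf_graded G -> gf_resolves I G ->
  @chain_map F G f -> @chain_map F G g ->
  forall i, exists s t,
    [/\ graded_mx (deg F i) (deg G i.+1) s,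
        graded_mx (@gf_out_deg F i) (deg G i) t &
        f i - g i = s *m gf_diff G i + gf_out F i *m t].
Proof.
move=> gF rF gG rG [gf augf cf] [gg augg cg].
have gfg i := graded_mxB (gf i) (gg i).
elim=> [|i [s [t [gs gt fgE]]]].
  have [|s gs fgE] := gf_cycle_lift gG rG (gfg 0%N).
    have := ideal_mxB idI augg augf.
    by rewrite opprB addrC addrA subrK -mulmxBl.
  exists s, (0 : 'M_(0, _)); split=> //; first by case.
  by rewrite fgE mulmx0 addr0.
have cyc : gf_cycle (f i.+1 - g i.+1 - gf_diff F i *m s).
  rewrite /= mulmxBl mulmxBl -cf -cg -mulmxBr fgE mulmxDr -!mulmxA addrC addKr.
  case: i {s fgE gs gfg} t gt => [|i] t gt /=; first by rewrite mul0mx mulmx0.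
  by rewrite mulmxA (gf_cycle_diff i.+1 rF) mul0mx.
have gr := graded_mxB (gfg i.+1) (graded_mxM (gF.2 i) gs).
have [s' gs' s'E] := gf_cycle_lift gG rG gr cyc.
by exists s', s; rewrite -s'E subrK.
Qed.

Lemma minimal_comparison F G i :
  minimal_graded_free_resolution I F -> gf_graded G -> gf_resolves I G ->
  exists f g s t,
    [/\ [/\ deg_preserving (deg F i) (deg G i) f,
            deg_preserving (deg G i) (deg F i) g &
            deg_preserving (deg G i) (deg G i.+1) s],
        f *m g = 1%:M,
        coef0_mx (gf_diff G i) *m g = 0,
        f *m coef0_mx (gf_out G i) = 0 &
        1%:M = g *m f + s *m coef0_mx (gf_diff G i) +
               coef0_mx (gf_out G i) *m t].
Proof.
move=> [gF rF minF] gG rG.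
have diffF0 k : coef0_mx (gf_diff F k) = 0.
  by apply/matrixP=> a b; rewrite !mxE; apply: minF.
have outF0 : coef0_mx (gf_out F i) = 0.
  by case: i => [|k] /=; [rewrite /coef0_mx map_mx0 | apply: diffF0].
have [f mapf] := chain_map_exists gF rF gG rG.
have [g mapg] := chain_map_exists gG rG gF rF.
have [s [t [_ _ fgE]]] := chain_map_homotopy gF rF gF rF
  (chain_map_id F) (chain_map_comp mapf mapg) i.
have [u [v [gu _ gfE]]] := chain_map_homotopy gG rG gG rG
  (chain_map_id G) (chain_map_comp mapg mapf) i.
have [gf _ cf] := mapf; have [gg _ cg] := mapg.
exists (coef0_mx (f i)), (coef0_mx (g i)), (coef0_mx u), (coef0_mx v).
rewrite -!coef0_mxM; split; first by split; apply: graded_mx_coef0.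
- have := congr1 (@coef0_mx n K _ _) fgE.
  rewrite /coef0_mx map_mxB map_mxD map_mx1 -!/(coef0_mx _).
  rewrite (coef0_mxM s) (coef0_mxM _ t) diffF0 outF0 mulmx0 mul0mx addr0.
  by move/subr0_eq.
- by rewrite cg coef0_mxM diffF0 mulmx0.
- case: i {s t u v gu fgE gfE outF0} => [|i] /=.
    by rewrite mulmx0 /coef0_mx map_mx0.
  by rewrite -cf coef0_mxM diffF0 mul0mx.
- by rewrite /coef0_mx -!map_mxD -addrA -gfE addrC subrK map_mx1.
Qed.

End Comparison.

Section DegreeProjections.
Variable K : fieldType.

Definition deg_proj m (dA : 'I_m -> int) (j : int) : 'M[K]_m :=
  diag_mx (\row_a (dA a == j)%:R).

Lemma deg_projM m q (dA : 'I_m -> int) (dB : 'I_q -> int) j (M : 'M_(m, q)) :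
  deg_preserving dA dB M -> deg_proj dA j *m M = M *m deg_proj dB j.
Proof.
move=> degM; apply/matrixP=> a b; rewrite mul_diag_mx mul_mx_diag !mxE mulrC.
by have [->|/degM ->//] := eqVneq (M a b) 0; rewrite !mul0r.
Qed.

Lemma deg_proj_id m (dA : 'I_m -> int) j :
  deg_proj dA j *m deg_proj dA j = deg_proj dA j.
Proof.
rewrite mulmx_diag; congr diag_mx; apply/rowP=> a.
by rewrite !mxE -natrM mulnb andbb.
Qed.

Lemma rank_deg_proj m (dA : 'I_m -> int) j :
  \rank (deg_proj dA j) = #|[set a | dA a == j]|.
Proof.
set A := [set a | _].
pose E : 'M[K]_(#|A|, m) := \matrix_k delta_mx 0 (enum_val k).
have projE : E *m deg_proj dA j = E.
  apply/matrixP=> k b; rewrite mul_mx_diag !mxE /=.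
  have [-> | _] := eqVneq b (enum_val k); last by rewrite mul0r.
  by have := enum_valP k; rewrite inE => ->; rewrite mulr1.
have E_free : row_free E.
  apply/row_freeP; exists E^T; apply/matrixP=> k l; rewrite !mxE.
  rewrite (bigD1 (enum_val k)) //= !mxE !eqxx mul1r (inj_eq enum_val_inj).
  by rewrite big1 ?addr0 // => b /negbTE bk; rewrite !mxE bk andbF mul0r.
apply/eqP; rewrite eqn_leq -(eqP E_free) -{2}projE mxrankM_maxr andbT.
apply/mxrankS/row_subP=> a.
rewrite row_diag_mx !mxE; case: eqP => [aj|_]; last by rewrite scale0r sub0mx.
have aA : a \in A by rewrite inE aj.
rewrite scale1r -(enum_rankK_in aA aA).
by rewrite -(rowK (fun k => delta_mx 0 (enum_val k))) row_sub.
Qed.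

(* The homology of (din, dout), computed on the images of the projections. *)
Lemma rank_contraction m r p q (pF : 'M[K]_m) (pG : 'M_r) (pH : 'M_p)
    (f : 'M_(m, r)) (g : 'M_(r, m)) (din : 'M_(p, r)) (dout : 'M_(r, q)) s t :
  pF *m f = f *m pG -> pG *m g = g *m pF ->
  pG *m s = s *m pH -> pH *m din = din *m pG ->
  f *m g = 1%:M -> f *m dout = 0 -> din *m g = 0 -> din *m dout = 0 ->
  1%:M = g *m f + s *m din + dout *m t ->
  (\rank pF + \rank (pH *m din) + \rank (pG *m dout) = \rank pG)%N.
Proof.
move=> pf pg ps pdin fg fdout ding dd homotopy.
have f_free : row_free f by apply/row_freeP; exists g.
have cycles : (pG :&: kermx dout :=: pF *m f + pH *m din)%MS.
  apply/eqmxP/andP; split; last first.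
    rewrite addsmx_sub !sub_capmx !sub_kermx -!mulmxA fdout dd !mulmx0.
    by rewrite pf pdin !submxMl !eqxx.
  set Z := (_ :&: _)%MS; have /submxP[w Zw] : (Z <= pG)%MS by apply: capmxSl.
  have Zdout : Z *m dout = 0 by apply/sub_kermxP/capmxSr.
  have -> : Z = w *m g *m (pF *m f) + w *m s *m (pH *m din).
    rewrite -[LHS]mulmx1 homotopy !mulmxDr [Z *m (dout *m t)]mulmxA Zdout.
    by rewrite mul0mx addr0 !mulmxA Zw -!(mulmxA w) pg ps !mulmxA.
  by rewrite addmx_sub_adds ?submxMl.
have disjoint : (pF *m f :&: pH *m din = 0)%MS.
  apply/eqP/rowV0P=> v; rewrite sub_capmx => /andP[/submxP[u ->] /submxP[w uw]].
  have : u *m (pF *m f) *m g = 0 by rewrite uw -!mulmxA ding !mulmx0.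
  by rewrite -!mulmxA fg mulmx1 mulmxA => ->; rewrite mul0mx.
have := mxrank_mul_ker pG dout.
rewrite cycles (mxrank_disjoint_sum disjoint) (mxrankMfree _ f_free); lia.
Qed.

End DegreeProjections.

Section BettiNumbers.
Variables (n : nat) (K : fieldType) (I : {mpoly K[n]} -> Prop).
Hypothesis homI : is_homog_ideal I.
Variables F G : gfree_seq n K.
Hypothesis minF : minimal_graded_free_resolution I F.
Hypotheses (gG : gf_graded G) (rG : gf_resolves I G).
Local Notation deg G i := (@gf_deg n K G i).

Definition strand_rank i j :=
  \rank (deg_proj K (deg G i) j *m coef0_mx (gf_out G i)).

Lemma gf_betti_strand i j :
  (gf_betti F i j + strand_rank i.+1 j + strand_rank i j = gf_betti G i j)%N.
Proof.
have [f [g [s [t [[degf degg degs] fg ding fdout homotopy]]]]] :=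
  minimal_comparison homI i minF gG rG.
rewrite /gf_betti -!(rank_deg_proj K).
apply: rank_contraction fg fdout ding _ homotopy; try exact: deg_projM.
- exact/deg_projM/graded_mx_coef0/gG.2.
- rewrite -coef0_mxM; case: i {f g s t degf degg degs} => [|i].
    by rewrite mulmx0 /coef0_mx map_mx0.
  by rewrite [_ *m _](gf_cycle_diff i.+1 rG) /coef0_mx map_mx0.
Qed.

Lemma gf_betti_eq0 i j :
  (forall z : 'rV_(gf_rank G i), z *m deg_proj K (deg G i) j = z ->
     z *m coef0_mx (gf_out G i) = 0 -> (z <= coef0_mx (gf_diff G i))%MS) ->
  gf_betti F i j = 0%N.
Proof.
set pG := deg_proj _ _ _; set dout := coef0_mx _ => exact_ij.
have : (\rank (pG :&: kermx dout)%MS <= strand_rank i.+1 j)%N.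
  apply/mxrankS/rV_subP=> z; rewrite sub_capmx sub_kermx.
  case/andP=> /submxP[w zE] /eqP zdout.
  have pz : z *m pG = z by rewrite zE -mulmxA deg_proj_id.
  have /submxP[u zu] := exact_ij z pz zdout.
  rewrite -pz {}zu -mulmxA -(deg_projM _ (graded_mx_coef0 (gG.2 i))).
  exact: submxMl.
have bettiG : gf_betti G i j = \rank pG by rewrite rank_deg_proj.
have := mxrank_mul_ker pG dout; have := gf_betti_strand i j.
by rewrite bettiG -[\rank (pG *m dout)]/(strand_rank i j); lia.
Qed.

End BettiNumbers.

(** * Minimalization by cancelling unit entries *)

Section LinearCombinations.
Variables (R : comPzRingType) (X : finType).
Implicit Types (P : {set X}) (v w a : X -> R) (D : X -> X -> R).

Definition lincomb P v a : R := \sum_(x in P) v x * a x.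

Definition boundary P D v (y : X) : R := lincomb P v (D^~ y).

Lemma eq_lincomb P v w a : {in P, v =1 w} -> lincomb P v a = lincomb P w a.
Proof. by move=> vw; apply: eq_bigr => x /vw ->. Qed.

Lemma lincombBM P v w a c :
  lincomb P (fun x => v x - c * w x) a = lincomb P v a - c * lincomb P w a.
Proof. by rewrite mulr_sumr -sumrB; apply: eq_bigr => x _; ring. Qed.

Lemma lincomb_delta P a x : x \in P -> lincomb P (fun y => (x == y)%:R) a = a x.
Proof.
move=> xP; rewrite /lincomb (bigD1 x) //= eqxx mul1r big1 ?addr0 // => y.
by case/andP=> _; rewrite eq_sym => /negbTE ->; rewrite mul0r.
Qed.

End LinearCombinations.

Section BasedResolutions.
Variables (n : nat) (K : fieldType) (I : {mpoly K[n]} -> Prop).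
Hypothesis idI : is_ideal I.
Local Notation S := {mpoly K[n]}.
Variables (X : finType) (hd : X -> nat) (dg : X -> int).
Implicit Types (P : {set X}) (D : X -> X -> S) (aug v w : X -> S).

(* A graded free resolution with all its bases collected in one finite type X:
   hd and dg are the homological and internal degrees, P is the set of basis
   elements in use, and D is the matrix of the total differential.  Keeping X
   fixed and shrinking P avoids dependent types when basis elements are
   cancelled.  Since aug lives in hd 0 and D lowers hd by one, based_exact says
   that all homology of the augmented complex vanishes. *)
Record based_res P D aug : Prop := BasedRes {
  based_hd : forall x y, hd x != (hd y).+1 -> D x y = 0;
  based_aug_hd : forall x, hd x != 0%N -> aug x = 0;
  based_dg : forall x y, zhomog (dg x - dg y) (D x y);
  based_aug_dg : forall x, zhomog (dg x) (aug x);
  based_sq : forall v, {in P, boundary P D (boundary P D v) =1 fun=> 0};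
  based_aug_boundary : forall v, I (lincomb P (boundary P D v) aug);
  based_surj : forall p, exists v, I (p - lincomb P v aug);
  based_exact : forall v, {in P, boundary P D v =1 fun=> 0} ->
    I (lincomb P v aug) -> exists w, {in P, v =1 boundary P D w} }.

Arguments based_dg [P D aug] res x y : rename.
Arguments based_aug_dg [P D aug] res x : rename.

Definition based_minimal P D : Prop :=
  {in P &, forall x y, (D x y)@_0%MM = 0}.

Section Cancellation.
Variables (P : {set X}) (D : X -> X -> S) (aug : X -> S) (x0 y0 : X).
Hypothesis res : based_res P D aug.
Hypotheses (x0P : x0 \in P) (y0P : y0 \in P).
Hypothesis unit_entry : (D x0 y0)@_0%MM != 0.

Let P' := P :\ x0 :\ y0.
Let c : S := ((D x0 y0)@_0%MM)^-1%:MP.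

Definition schur_complement x y : S := D x y - D x y0 * c * D x0 y.

(* The extension of v to P whose boundary vanishes at y0. *)
Definition cancel_lift v x : S :=
  if x == x0 then - (lincomb P' v (D^~ y0) * c)
  else if x == y0 then 0 else v x.

Let hd_x0 : hd x0 = (hd y0).+1.
Proof.
by apply/eqP; apply: contraNT unit_entry => /(based_hd res) ->; rewrite mcoeff0.
Qed.

Let dg_x0 : dg x0 = dg y0.
Proof. exact: subr0_eq (zhomog_mcoeff0 (based_dg res x0 y0) unit_entry). Qed.

Let x0_neq_y0 : x0 != y0.
Proof. by apply: contra_eqN hd_x0 => /eqP ->; rewrite neq_ltn ltnSn. Qed.

Let aug_x0 : aug x0 = 0.
Proof. by rewrite (based_aug_hd res) ?hd_x0. Qed.

Let c_inv : c * D x0 y0 = 1.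
Proof.
have := based_dg res x0 y0; rewrite dg_x0 subrr => /zhomog_const D_const.
by rewrite [D x0 y0 in LHS]D_const -mpolyCM mulVf.
Qed.

Let sub_P' : {subset P' <= P}.
Proof. by move=> x; rewrite !inE => /and3P[]. Qed.

Let lincomb_split v a :
  lincomb P v a = v x0 * a x0 + (v y0 * a y0 + lincomb P' v a).
Proof.
by rewrite /lincomb (big_setD1 x0) //= (big_setD1 y0) // !inE eq_sym x0_neq_y0.
Qed.

Lemma lincomb_cancel_lift v a :
  lincomb P (cancel_lift v) a =
  lincomb P' v (fun x => a x - D x y0 * c * a x0).
Proof.
rewrite lincomb_split /cancel_lift eqxx eqxx.
rewrite [y0 == x0]eq_sym (negbTE x0_neq_y0) mul0r add0r.
rewrite (eq_lincomb (w := v)) => [|x]; last first.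
  by rewrite !inE => /and3P[/negbTE -> /negbTE ->].
rewrite /lincomb !mulr_suml -sumrN mulr_suml -big_split /=.
by apply: eq_bigr => x _; ring.
Qed.

Lemma boundary_cancel_lift v :
  boundary P D (cancel_lift v) =1 boundary P' schur_complement v.
Proof. by move=> y; rewrite /boundary lincomb_cancel_lift. Qed.

Lemma augment_cancel_lift v : lincomb P (cancel_lift v) aug = lincomb P' v aug.
Proof.
rewrite lincomb_cancel_lift; apply: eq_bigr => x _.
by rewrite aug_x0 mulr0 subr0.
Qed.

Lemma cancel_lift_id v :
  v y0 = 0 -> boundary P D v y0 = 0 -> {in P, cancel_lift v =1 v}.
Proof.
move=> v0 dv0 x xP; rewrite /cancel_lift.
case: eqVneq => [->|_]; last by case: eqVneq => // ->.
move: dv0; rewrite /boundary lincomb_split v0 mul0r add0r => /eqP.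
rewrite addrC addr_eq0 => /eqP ->; ring: c_inv.
Qed.

Lemma schur_boundary_cycle v :
  boundary P' schur_complement v y0 = 0.
Proof.
rewrite /boundary /lincomb big1 // => x _.
by rewrite /schur_complement; ring: c_inv.
Qed.

(* Subtracting a multiple of the boundary of x0 clears the coefficient of y0. *)
Lemma clear_coefficient v : exists w,
  [/\ w y0 = 0, {in P, boundary P D w =1 boundary P D v} &
      I (lincomb P v aug - lincomb P w aug)].
Proof.
have D_x0 y : boundary P D (fun x => (x0 == x)%:R) y = D x0 y.
  by rewrite /boundary lincomb_delta.
have dD_x0 : {in P, boundary P D (D x0) =1 fun=> 0}.
  move=> y yP; rewrite -(based_sq res (fun x => (x0 == x)%:R) yP).
  by apply: eq_lincomb => x _; rewrite D_x0.
exists (fun x => v x - v y0 * c * D x0 x); split=> [|y yP|].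
- by rewrite -mulrA c_inv mulr1 subrr.
- by rewrite /boundary lincombBM -/(boundary P D (D x0) y) dD_x0 // mulr0 subr0.
- rewrite lincombBM subKr; apply: (idealMl idI).
  have := based_aug_boundary res (fun x => (x0 == x)%:R).
  by rewrite (eq_lincomb (w := D x0)).
Qed.

Lemma schur_complement_homog x y : zhomog (dg x - dg y) (schur_complement x y).
Proof.
apply: zhomogB; first exact: based_dg res _ _.
have -> : dg x - dg y = (dg x - dg y0) + 0 + (dg x0 - dg y).
  by rewrite addr0 dg_x0 addrA subrK.
by do !apply: zhomogM; try exact: based_dg res _ _; apply: zhomogC.
Qed.

Lemma cancel_lift_boundary v :
  {in P, cancel_lift (boundary P' schur_complement v) =1
         boundary P D (cancel_lift v)}.
Proof.
move=> x xP; rewrite boundary_cancel_lift cancel_lift_id //.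
  exact: schur_boundary_cycle.
rewrite -(based_sq res (cancel_lift v) y0P).
by apply: eq_lincomb => y _; rewrite boundary_cancel_lift.
Qed.

Lemma schur_complement_exact v :
  {in P', boundary P' schur_complement v =1 fun=> 0} ->
  I (lincomb P' v aug) ->
  exists w, {in P', v =1 boundary P' schur_complement w}.
Proof.
move=> cyc_v Iv.
have dlift : {in P, boundary P D (cancel_lift v) =1 fun=> 0}.
  move=> y yP; rewrite -cancel_lift_boundary // /cancel_lift.
  case: eqVneq => [_|yx0].
    by rewrite /lincomb big1 ?mul0r ?oppr0 // => x /cyc_v ->; rewrite mul0r.
  by case: eqVneq => // yy0; apply: cyc_v; rewrite !inE yy0 yx0.
have [|w wE] := based_exact res dlift; first by rewrite augment_cancel_lift.
have [w' [w'0 dw' _]] := clear_coefficient w.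
have lift_w' : {in P, cancel_lift w' =1 w'}.
  apply: cancel_lift_id => //; rewrite dw' // -wE // /cancel_lift.
  by rewrite [y0 == x0]eq_sym (negbTE x0_neq_y0) eqxx.
exists w' => y yP'; have yP := sub_P' yP'.
rewrite -boundary_cancel_lift {1}/boundary (eq_lincomb _ lift_w').
rewrite -/(boundary P D w' y) dw' // -wE // /cancel_lift.
by move: yP'; rewrite !inE => /and3P[/negbTE -> /negbTE ->].
Qed.

Lemma schur_complement_res : based_res P' schur_complement aug.
Proof.
split=> [x y hxy|||||v|p|v].
- rewrite /schur_complement (based_hd res hxy).
  have [hx|/(based_hd res) ->] := eqVneq (hd x) (hd y0).+1; last by ring.
  by rewrite (based_hd res (x := x0) (y := y)) ?hd_x0 -?hx //; ring.
- exact: based_aug_hd res.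
- exact: schur_complement_homog.
- exact: based_aug_dg res.
- move=> v y /sub_P' yP; rewrite -boundary_cancel_lift.
  rewrite /boundary (eq_lincomb _ (cancel_lift_boundary v)).
  exact: based_sq res (cancel_lift v) y yP.
- rewrite -augment_cancel_lift (eq_lincomb _ (cancel_lift_boundary v)).
  exact: based_aug_boundary res _.
- have [v Iv] := based_surj res p; have [w [w0 _ Iw]] := clear_coefficient v.
  exists w; have := idealD idI Iv Iw; rewrite addrA subrK.
  by rewrite [lincomb P w aug]lincomb_split aug_x0 w0 mulr0 mul0r !add0r.
- exact: schur_complement_exact.
Qed.

End Cancellation.

Lemma based_res_minimalize P D aug :
  based_res P D aug -> exists P' D', based_res P' D' aug /\ based_minimal P' D'.
Proof.
have [k] := ubnP #|P|; elim: k P D => // k IHk P D ltPk res.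
have [/forall_inP minP|] :=
    boolP [forall x in P, forall y in P, (D x y)@_0%MM == 0].
  by exists P, D; split=> // x y /minP/forall_inP Dx /Dx/eqP.
case/forall_inPn=> x0 x0P /forall_inPn[y0 y0P unit_entry].
apply: IHk (schur_complement_res res x0P y0P unit_entry).
rewrite ltnS in ltPk; apply: leq_trans ltPk; rewrite (cardsD1 x0 P) x0P ltnS.
exact/subset_leq_card/subD1set.
Qed.

End BasedResolutions.

Section HomologicalLevels.
Variables (X : finType) (hd : X -> nat) (P : {set X}) (R : comPzRingType).
Implicit Types (v : X -> R) (D : X -> X -> R).

Definition level i := [set x in P | hd x == i].

Definition level_row i v : 'rV[R]_#|level i| := \row_k v (enum_val k).

Definition level_mx i D : 'M[R]_(#|level i.+1|, #|level i|) :=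
  \matrix_(a, b) D (enum_val a) (enum_val b).

Lemma level_enum_val i (k : 'I_#|level i|) :
  enum_val k \in P /\ hd (enum_val k) = i.
Proof. by have := enum_valP k; rewrite inE => /andP[kP /eqP]. Qed.

Lemma sum_level i v : (forall x, hd x != i -> v x = 0) ->
  \sum_(x in P) v x = \sum_(k < #|level i|) v (enum_val k).
Proof.
move=> v0; rewrite -big_enum_val [LHS](bigID (fun x => hd x == i)) /=.
rewrite [X in _ + X]big1 ?addr0 => [|x /andP[_ /v0 //]].
by apply: eq_bigl => x; rewrite inE.
Qed.

Lemma level_row_surj i (u : 'rV[R]_#|level i|) :
  exists2 v, u = level_row i v & forall x, x \notin level i -> v x = 0.
Proof.
exists (fun x => \sum_k u 0 k *+ (enum_val k == x)) => [|x xi].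
  apply/rowP=> k; rewrite mxE (bigD1 k) //= eqxx big1 ?addr0 // => l /negbTE lk.
  by rewrite (inj_eq enum_val_inj) lk.
rewrite big1 // => k _; case: eqP => // xk.
by rewrite -xk enum_valP in xi.
Qed.

Lemma eq_level_row i v v' :
  level_row i v = level_row i v' <-> {in level i, v =1 v'}.
Proof.
split=> [vv' x xi|vv'].
  by have /rowP/(_ (enum_rank_in xi x)) := vv'; rewrite !mxE enum_rankK_in.
by apply/rowP=> k; rewrite !mxE vv' // enum_valP.
Qed.

Section Boundary.
Variable D : X -> X -> R.
Hypothesis D_hd : forall x y, hd x != (hd y).+1 -> D x y = 0.

Lemma level_row_boundary i v :
  level_row i.+1 v *m level_mx i D = level_row i (boundary P D v).
Proof.
apply/rowP=> k; rewrite !mxE /boundary /lincomb (@sum_level i.+1) => [|x xi].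
  by apply: eq_bigr => a _; rewrite !mxE.
by rewrite D_hd ?mulr0 // (level_enum_val k).2.
Qed.

Lemma boundary_eq0 i v y : (forall x, x \notin level i -> v x = 0) ->
  (hd y).+1 != i -> boundary P D v y = 0.
Proof.
move=> v0 yi; rewrite /boundary /lincomb big1 // => x xP.
have [xi|xi] := eqVneq (hd x) i; last first.
  by rewrite v0 ?mul0r // inE (negbTE xi) andbF.
by rewrite D_hd ?mulr0 // xi eq_sym.
Qed.

Lemma boundary_eq0_level i v : (forall x, x \notin level i.+1 -> v x = 0) ->
  level_row i (boundary P D v) = 0 -> {in P, boundary P D v =1 fun=> 0}.
Proof.
move=> v0 dv y yP.
have [yi|yi] := eqVneq (hd y) i; last exact: boundary_eq0 v0 _.
have zero_row : (0 : 'rV_#|level i|) = level_row i (fun=> 0).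
  by apply/rowP=> k; rewrite !mxE.
have /eq_level_row -> // : level_row i (boundary P D v) = level_row i (fun=> 0).
  by rewrite dv zero_row.
by rewrite inE yP yi eqxx.
Qed.

End Boundary.
End HomologicalLevels.

Section GradedFreeSequence.
Variables (n : nat) (K : fieldType) (I : {mpoly K[n]} -> Prop).
Hypothesis homI : is_homog_ideal I.
Local Notation S := {mpoly K[n]}.
Variables (X : finType) (hd : X -> nat) (dg : X -> int).

Section OfBasedResolution.
Variables (P : {set X}) (D : X -> X -> S) (aug : X -> S).

Definition gf_of : gfree_seq n K :=
  @GFreeSeq n K (fun i => #|level hd P i|) (fun i k => dg (enum_val k))
    (\col_k aug (enum_val k)) (fun i => level_mx hd P i D).

Lemma gf_betti_of i j :
  gf_betti gf_of i j = #|[set x in P | (hd x == i) && (dg x == j)]|.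
Proof.
rewrite /gf_betti -(card_imset _ enum_val_inj); apply: eq_card => x.
rewrite [RHS]inE; apply/imsetP/and3P => [[k]|[xP xi xj]].
  by rewrite inE /= => kj ->; have [-> ->] := level_enum_val k; rewrite eqxx.
have xl : x \in level hd P i by rewrite inE xP xi.
by exists (enum_rank_in xl x); rewrite ?inE /= enum_rankK_in.
Qed.

Hypothesis res : based_res I hd dg P D aug.

Lemma gf_of_graded : gf_graded gf_of.
Proof.
split=> [k|i a b]; rewrite mxE.
  exact: based_aug_dg res _.
exact: based_dg res _ _.
Qed.

Lemma gf_of_minimal : based_minimal P D -> gf_minimal gf_of.
Proof.
by move=> minD i a b; rewrite mxE; apply: minD; rewrite (level_enum_val _).1.
Qed.

Lemma level_row_augment v :
  (level_row hd P 0 v *m gf_aug gf_of) 0 0 = lincomb P v aug.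
Proof.
rewrite mxE /lincomb (@sum_level _ hd _ _ 0) => [|x x0].
  by apply: eq_bigr => k _; rewrite !mxE.
by rewrite (based_aug_hd res) ?mulr0.
Qed.

Lemma gf_of_resolves : gf_resolves I gf_of.
Proof.
have Dhd := based_hd res.
have boundary_row i v w : {in P, v =1 boundary P D w} ->
    level_row hd P i v = level_row hd P i.+1 w *m gf_diff gf_of i.
  move=> vw; rewrite level_row_boundary //; apply/eq_level_row => x.
  by rewrite inE => /andP[/vw].
split=> [p|u|i u].
- have [v Iv] := based_surj res p.
  by exists (level_row hd P 0 v); rewrite level_row_augment.
- split=> [Iu|[u' ->]].
    have [v uv v0] := level_row_surj u; subst u.
    have [|/=|w /boundary_row ->] := based_exact res (v := v).
    + by move=> y _; apply: boundary_eq0 v0 _.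
    + by rewrite -level_row_augment.
    by exists (level_row hd P 1 w).
  have [w -> _] := level_row_surj u'.
  rewrite level_row_boundary // level_row_augment.
  exact: based_aug_boundary res _.
- split=> [du|[u' ->]].
    have [v uv v0] := level_row_surj u; subst u.
    rewrite level_row_boundary // in du.
    have [||w /boundary_row ->] := based_exact res (v := v).
    + exact: boundary_eq0_level v0 du.
    + rewrite /lincomb big1 => [|x xP]; first by apply: ideal0; case: homI.
      have [x0|x0] := eqVneq (hd x) 0%N; last first.
        by rewrite (based_aug_hd res) ?mulr0.
      by rewrite v0 ?mul0r // inE x0 andbF.
    by exists (level_row hd P i.+2 w).
  have [w -> _] := level_row_surj u'; rewrite !level_row_boundary //.
  apply/rowP=> k; rewrite !mxE; apply: (based_sq res).
  exact: (level_enum_val k).1.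
Qed.

(* Only the constant terms of D matter, since F is compared with gf_of modulo
   the variables. *)
Lemma based_betti_eq0 F i j :
  minimal_graded_free_resolution I F ->
  (forall z : X -> K, (forall x, z x != 0 -> hd x = i /\ dg x = j) ->
     {in P, boundary P (fun x y => (D x y)@_0%MM) z =1 fun=> 0} ->
     exists w, {in P, z =1 boundary P (fun x y => (D x y)@_0%MM) w}) ->
  gf_betti F i j = 0%N.
Proof.
set D0 := fun x y => (D x y)@_0%MM => minF exact_ij.
have D0_hd x y : hd x != (hd y).+1 -> D0 x y = 0.
  by move=> hxy; rewrite /D0 (based_hd res hxy) mcoeff0.
have coef0_diff k : coef0_mx (gf_diff gf_of k) = level_mx hd P k D0.
  by apply/matrixP=> a b; rewrite !mxE.
apply: (gf_betti_eq0 homI minF gf_of_graded gf_of_resolves) => u projz outz.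
have [z uz z0] := level_row_surj u; subst u.
have [x zx|y yP|w zw] := exact_ij z.
- have xi : x \in level hd P i by apply: contraNT zx => /z0 ->.
  split; first by move: xi; rewrite inE => /andP[_ /eqP].
  have [//|/negbTE xj] := eqVneq (dg x) j.
  move/rowP/(_ (enum_rank_in xi x)): projz.
  rewrite mul_mx_diag !mxE /= enum_rankK_in // xj mulr0 => /esym/eqP.
  by rewrite (negbTE zx).
- case: i z projz outz z0 {exact_ij} => [|i] z _ outz z0.
    exact: (boundary_eq0 D0_hd z0).
  rewrite /= coef0_diff level_row_boundary // in outz.
  exact: (boundary_eq0_level D0_hd z0 outz).
rewrite coef0_diff; apply/submxP; exists (level_row hd P i.+1 w).
rewrite level_row_boundary //; apply/eq_level_row => x.
by rewrite inE => /andP[/zw].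
Qed.

End OfBasedResolution.

Lemma based_res_minimal_resolution P D aug :
  based_res I hd dg P D aug -> exists F, minimal_graded_free_resolution I F.
Proof.
move=> res; have [P' [D' [res' minD']]] := based_res_minimalize homI.1 res.
exists (gf_of P' D' aug); split.
- exact: gf_of_graded res'.
- exact: gf_of_resolves res'.
- exact: gf_of_minimal minD'.
Qed.

End GradedFreeSequence.

(** * Koszul complexes *)

Section KoszulComplex.
Variables (n : nat) (V : zmodType).
Implicit Types (i k : 'I_n) (J : {set 'I_n}) (u w : {set 'I_n} -> V).

Definition kos_sign i J : int := (-1) ^+ #|[set j in J | (j < i)%N]|.

(* An element u of V tensor the exterior algebra assigns to J the coefficient of
   the exterior monomial e_J; kos is the contraction with the operators phi, and
   kos_wedge the wedge product with the operators beta. *)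
Definition kos (phi : 'I_n -> V -> V) u J : V :=
  \sum_(i | i \notin J) phi i (u (i |: J)) *~ kos_sign i J.

Definition kos_wedge (beta : 'I_n -> V -> V) u J : V :=
  \sum_(i | i \in J) beta i (u (J :\ i)) *~ kos_sign i J.

Lemma kos_signU1 i k J : i \notin J ->
  kos_sign k (i |: J) = (-1) ^+ (i < k)%N * kos_sign k J.
Proof.
move=> iJ; rewrite /kos_sign -exprD; congr (_ ^+ _).
have [ik|ki] := ltnP i k.
  rewrite (_ : [set j in i |: J | _] = i |: [set j in J | (j < k)%N]).
    by rewrite cardsU1 inE (negbTE iJ).
  by apply/setP=> j; rewrite !inE; case: eqVneq => [->|] //=; rewrite ik.
apply: eq_card => j; rewrite !inE.
by case: eqVneq => [->|] //=; rewrite ltnNge ki (negbTE iJ).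
Qed.

Lemma kos_sign_setU1 i J : kos_sign i (i |: J) = kos_sign i J.
Proof.
congr (_ ^+ _); apply: eq_card => j; rewrite !inE.
by case: (eqVneq j i) => [->|]; rewrite ?ltnn ?andbF.
Qed.

Lemma kos_sign_setD1 i J : kos_sign i (J :\ i) = kos_sign i J.
Proof.
congr (_ ^+ _); apply: eq_card => j; rewrite !inE.
by case: (eqVneq j i) => [->|]; rewrite ?ltnn ?andbF.
Qed.

Lemma kos_signK i J : kos_sign i J * kos_sign i J = 1.
Proof. by rewrite -expr2 sqrr_sign. Qed.

Lemma sign_ltn_anti i k : i != k ->
  (-1) ^+ (k < i)%N = - (-1) ^+ (i < k)%N :> int.
Proof. by rewrite -val_eqE /=; case: ltngtP. Qed.

Lemma eq_kos phi u w J : (forall J, u J = w J) -> kos phi u J = kos phi w J.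
Proof. by move=> uw; apply: eq_bigr => i _; rewrite uw. Qed.

Section Additive.
Variable phi : 'I_n -> {additive V -> V}.

Lemma kos0 J : kos phi (fun=> 0) J = 0.
Proof. by rewrite /kos big1 // => i _; rewrite raddf0 mul0rz. Qed.

Lemma kosD u w J : kos phi (fun J => u J + w J) J = kos phi u J + kos phi w J.
Proof.
by rewrite -big_split; apply: eq_bigr => i _; rewrite raddfD mulrzDl.
Qed.

Lemma kosB u w J : kos phi (fun J => u J - w J) J = kos phi u J - kos phi w J.
Proof.
by rewrite -sumrB; apply: eq_bigr => i _; rewrite raddfB mulrzBl.
Qed.

Lemma kos_sum (T : finType) (P : pred T) (u : T -> {set 'I_n} -> V) J :
  kos phi (fun J => \sum_(t | P t) u t J) J = \sum_(t | P t) kos phi (u t) J.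
Proof.
rewrite /kos exchange_big; apply: eq_bigr => i _ /=.
by rewrite raddf_sum mulrz_suml.
Qed.

Lemma sum_antisymmetric (P : pred 'I_n) (T : 'I_n -> 'I_n -> V) :
  {in P &, forall i k, i != k -> T k i = - T i k} ->
  \sum_(i | P i) \sum_(k | P k && (k != i)) T i k = 0.
Proof.
move=> antiT.
transitivity (\sum_(i | P i) \sum_(k | P k && (k < i)%N) T i k +
              \sum_(i | P i) \sum_(k | P k && (i < k)%N) T i k).
  rewrite -big_split; apply: eq_bigr => i _.
  rewrite (bigID (fun k => k < i)%N) /=.
  congr (_ + _); apply: eq_bigl => k; rewrite -andbA -(inj_eq val_inj) /=.
    by case: ltngtP.
  by case: ltngtP.
rewrite [X in _ + X](exchange_big_dep P) /=; last by move=> i k _ /andP[].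
rewrite -big_split big1 //= => i Pi.
rewrite [X in _ + X](eq_bigl (fun k => P k && (k < i)%N)) => [|k]; last first.
  by rewrite Pi.
rewrite -big_split big1 //= => k /andP[Pk ki].
have ik : i != k by rewrite -(inj_eq val_inj) neq_ltn ki orbT.
by rewrite (antiT i k) // subrr.
Qed.

Lemma kos_kos u J :
  (forall i k v, phi i (phi k v) = phi k (phi i v)) ->
  kos phi (kos phi u) J = 0.
Proof.
move=> commphi.
pose T i k :=
  phi i (phi k (u (k |: (i |: J)))) *~ (kos_sign k (i |: J) * kos_sign i J).
rewrite -[RHS](@sum_antisymmetric (fun i => i \notin J) T) => [|i k iJ kJ ik].
  apply: eq_bigr => i iJ; rewrite raddf_sum mulrz_suml.
  apply: eq_big => [k|k _]; first by rewrite !inE negb_or andbC.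
  by rewrite raddfMz -mulrzA.
rewrite /T commphi setUCA -mulrNz; congr (_ *~ _).
rewrite (kos_signU1 _ kJ) (kos_signU1 _ iJ) (sign_ltn_anti ik); ring.
Qed.

(* The cross terms of the two composites cancel because contracting i and
   wedging k pick up opposite signs in the two orders. *)
Lemma kos_wedge_homotopy (beta : 'I_n -> {additive V -> V}) u J :
  (forall i k v, i != k -> beta k (phi i v) = phi i (beta k v)) ->
  kos phi (kos_wedge beta u) J + kos_wedge beta (kos phi u) J =
  \sum_(i | i \notin J) phi i (beta i (u J)) +
  \sum_(i | i \in J) beta i (phi i (u J)).
Proof.
move=> commbeta; pose cross i k := phi i (beta k (u (i |: (J :\ k)))).
have contract_wedge : kos phi (kos_wedge beta u) J =
    \sum_(i | i \notin J) phi i (beta i (u J)) +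
    \sum_(i | i \notin J) \sum_(k | k \in J)
      cross i k *~ (kos_sign k (i |: J) * kos_sign i J).
  rewrite -big_split; apply: eq_bigr => i iJ.
  rewrite /kos_wedge (bigD1 i) ?setU11 //= setU1K // kos_sign_setU1 //.
  rewrite raddfD mulrzDl raddfMz -mulrzA kos_signK; congr (_ + _).
  rewrite raddf_sum mulrz_suml; apply: eq_big => [k|k /andP[kJ ki]].
    by rewrite !inE; case: eqVneq => [->|] /=; rewrite ?andbT ?(negbTE iJ).
  rewrite raddfMz -mulrzA /cross; congr (phi i (beta k (u _)) *~ _).
  apply/setP=> j; rewrite !inE.
  by case: (eqVneq j i) => [->|]; rewrite ?orbF // eq_sym ki.
have wedge_contract : kos_wedge beta (kos phi u) J =
    \sum_(k | k \in J) beta k (phi k (u J)) +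
    \sum_(k | k \in J) \sum_(i | i \notin J)
      cross i k *~ (kos_sign i (J :\ k) * kos_sign k J).
  rewrite -big_split; apply: eq_bigr => k kJ.
  rewrite /kos (bigD1 k) ?setD11 //= setD1K // raddfD mulrzDl raddfMz -mulrzA.
  rewrite kos_sign_setD1 kos_signK; congr (_ + _).
  rewrite raddf_sum mulrz_suml; apply: eq_big => [i|i /andP[_ ik]].
    by rewrite !inE; case: eqVneq => [->|] /=; rewrite ?kJ ?andbT.
  by rewrite raddfMz -mulrzA commbeta.
rewrite contract_wedge wedge_contract addrACA [X in _ + X](_ : _ = 0) ?addr0 //.
rewrite [X in _ + X]exchange_big -big_split big1 //= => i iJ.
rewrite -big_split big1 //= => k kJ; rewrite -mulrzDr.
have ik : i != k by apply: contraNneq iJ => ->.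
have signE : kos_sign i (J :\ k) = (-1) ^+ (k < i)%N * kos_sign i J.
  rewrite -{2}(setD1K kJ) kos_signU1 ?setD11 // mulrA -expr2 sqrr_sign.
  by rewrite mul1r.
rewrite kos_signU1 // signE (sign_ltn_anti ik) (_ : _ + _ = 0) //; ring.
Qed.

End Additive.
End KoszulComplex.

Section KoszulMatrices.
Variables (n m : nat) (R : comPzRingType) (A : 'I_n -> 'M[R]_m).

Definition mulmxr_op i : {additive 'rV[R]_m -> 'rV[R]_m} := mulmxr (A i).

Definition kos_basis : finType := ({set 'I_n} * 'I_m)%type.

Definition kos_entry (x y : kos_basis) : R :=
  \sum_(i | (i \notin y.1) && (x.1 == i |: y.1))
     A i x.2 y.2 *~ kos_sign i y.1.

Lemma boundary_kos (v : kos_basis -> R) y :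
  boundary setT kos_entry v y =
  kos mulmxr_op (fun J => \row_a v (J, a)) y.1 0 y.2.
Proof.
case: y => J b.
rewrite /boundary /lincomb /= (eq_bigl xpredT) => [|x]; last exact: in_setT.
pose term J' a := v (J', a) * kos_entry (J', a) (J, b).
rewrite (eq_bigr (fun x => term x.1 x.2)) => [|[]//].
rewrite -(pair_bigA _ term) /term.
rewrite /kos_entry /=.
under eq_bigr do under eq_bigr do rewrite mulr_sumr.
under eq_bigr do rewrite exchange_big /=.
rewrite (exchange_big_dep (fun i => i \notin J)) /=; last first.
  by move=> J' i _ /andP[].
rewrite summxE; apply: eq_bigr => i iJ.
rewrite (big_pred1 (i |: J)) => [|J' /=]; last by rewrite iJ.
rewrite -scaler_int !mxE mulr_sumr; apply: eq_bigr => a _.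
by rewrite [in RHS]mxE -mulrzl mulrCA.
Qed.

Lemma mulmxr_op_comm : (forall i k, A i *m A k = A k *m A i) ->
  forall i k v, mulmxr_op i (mulmxr_op k v) = mulmxr_op k (mulmxr_op i v).
Proof. by move=> commA i k v; rewrite /= -!mulmxA commA. Qed.

End KoszulMatrices.

Lemma natr_neq0 (K : fieldType) k :
  [pchar K] =i pred0 -> (0 < k)%N -> k%:R != 0 :> K.
Proof. by move=> /pcharf0P ->; rewrite lt0n. Qed.

Section Euler.
Variables (n : nat) (K : fieldType).
Implicit Types (p : {mpoly K[n]}) (m : 'X_{1.. n}).

Lemma euler_monomial m :
  \sum_i 'X_i * ('X_[m])^`M(i) = (mdeg m)%:R *: 'X_[m] :> {mpoly K[n]}.
Proof.
rewrite mdegE natr_sum scaler_suml; apply: eq_bigr => i _.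
rewrite mderivX -scalerAr.
have [->|mi] := posnP (m i); first by rewrite !scale0r.
rewrite -mpolyXD addmC submK //; apply/mnm_lepP => k.
by rewrite mnm1E; case: eqVneq => [<-|].
Qed.

Lemma mcoeff_euler p m :
  (\sum_i 'X_i * p^`M(i))@_m = p@_m *+ mdeg m.
Proof.
have -> : \sum_i 'X_i * p^`M(i) =
    \sum_(k <- msupp p) (p@_k * (mdeg k)%:R) *: 'X_[k].
  under eq_bigr => i _ do rewrite {1}[p]mpolyE linear_sum mulr_sumr.
  rewrite exchange_big; apply: eq_bigr => k _ /=.
  rewrite -scalerA -euler_monomial scaler_sumr; apply: eq_bigr => i _.
  by rewrite mderivZ scalerAr.
rewrite [in RHS](mpolyE p) [LHS]raddf_sum [X in X *+ _]raddf_sum -sumrMnl.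
apply: eq_bigr => k _ /=.
rewrite !mcoeffZ mcoeffX.
have [->|_] := eqVneq k m; last by rewrite !mulr0 mul0rn.
by rewrite !mulr1 mulr_natr.
Qed.

Lemma dhomog_mderiv d p i : p \is d.+1.-homog -> p^`M(i) \is d.-homog.
Proof.
move=> /zhomog_dhomog/zhomogP homp; apply/zhomog_dhomog/zhomogP=> m md.
rewrite mcoeff_mderiv homp ?mul0rn //.
by rewrite mdegD mdeg1 addn1 eqz_nat eqSS -eqz_nat.
Qed.

Lemma homog_split d p : [pchar K] =i pred0 -> p \is d.+1.-homog ->
  exists2 u : 'I_n -> {mpoly K[n]},
    forall i, u i \is d.-homog & p = \sum_i 'X_i * u i.
Proof.
move=> charK homp; exists (fun i => d.+1%:R^-1 *: p^`M(i)) => [i|].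
  by rewrite rpredZ // dhomog_mderiv.
under eq_bigr do rewrite -scalerAr.
rewrite -scaler_sumr; apply/mpolyP=> m; rewrite mcoeffZ mcoeff_euler.
have [->|md] := eqVneq (mdeg m) d.+1.
  by rewrite -[p@_m *+ _]mulr_natl mulrA mulVf ?mul1r // natr_neq0.
by rewrite (dhomog_nemf_coeff homp) // mul0rn mulr0.
Qed.

End Euler.

Section GradedBasis.
Variables (n : nat) (K : fieldType) (I : {mpoly K[n]} -> Prop).
Local Notation S := {mpoly K[n]}.

Definition basis_comb m (E : 'cV[S]_m) (c : 'rV[K]_m) : S :=
  \sum_b c 0 b *: E b 0.

Definition graded_basis m (E : 'cV[S]_m) (dgE : 'I_m -> nat) : Prop :=
  [/\ forall a, E a 0 \is (dgE a).-homog,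
      forall c, I (basis_comb E c) -> c = 0 &
      forall p, exists c, I (p - basis_comb E c)].

Lemma basis_comb_is_linear m (E : 'cV[S]_m) : linear (basis_comb E).
Proof.
move=> x c d; rewrite scaler_sumr -big_split; apply: eq_bigr => b _ /=.
by rewrite !mxE scalerDl scalerA.
Qed.

HB.instance Definition _ m (E : 'cV[S]_m) :=
  GRing.isLinear.Build K 'rV[K]_m S _ (basis_comb E) (basis_comb_is_linear E).

Lemma has_dim_mod0 (V : S -> Prop) p : has_dim_mod V I 0 -> V p -> I p.
Proof. by case=> e [_ _ spanV] /spanV[c]; rewrite big_ord0 subr0. Qed.

Lemma ideal_sub_pihomog N p : is_ideal I ->
  (forall d q, (N <= d)%N -> q \is d.-homog -> I q) ->
  I (p - \sum_(d < N) pihomog mdeg d p).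
Proof.
move=> idI highI; have p_le : (mmeasure mdeg p <= maxn (msize p) N)%N.
  exact: leq_maxl.
rewrite {1}(pihomog_partitionE p_le) (bigID (fun d : 'I__ => d < N)%N) /=.
rewrite (big_ord_narrow (leq_maxr _ _)) /= addrC addrK.
apply: (ideal_sum idI) => d; rewrite -leqNgt => Nd.
exact: highI Nd (pihomogP _ _ _).
Qed.

Lemma big_tagged_enum_val (R : Type) (idx : R) (op : Monoid.com_law idx)
    (N : nat) (r : 'I_N -> nat) (F : {d : 'I_N & 'I_(r d)} -> R) :
  \big[op/idx]_(a < #|{: {d : 'I_N & 'I_(r d)}}|) F (enum_val a) =
  \big[op/idx]_(d < N) \big[op/idx]_(k < r d)
    F (existT (fun d => 'I_(r d)) d k).
Proof.
by rewrite -big_enum_val sig_big_dep; apply: eq_big => -[d k].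
Qed.

Section Concatenation.
Hypothesis homI : is_homog_ideal I.
Variables (N : nat) (r : 'I_N -> nat) (e : forall d : 'I_N, 'I_(r d) -> S).
Arguments e : clear implicits.
Hypothesis e_homog : forall d k, e d k \is d.-homog.
Hypothesis e_free : forall (d : 'I_N) (c : 'I_(r d) -> K),
  I (\sum_k c k *: e d k) -> forall k, c k = 0.
Hypothesis e_span : forall (d : 'I_N) p, p \is d.-homog ->
  exists c : 'I_(r d) -> K, I (p - \sum_k c k *: e d k).
Hypothesis high_degree : forall d p, (N <= d)%N -> p \is d.-homog -> I p.

Let T : finType := {d : 'I_N & 'I_(r d)}.

Definition concat_col : 'cV[S]_#|T| :=
  \col_a e (tag (enum_val a)) (tagged (enum_val a)).

Definition concat_deg (a : 'I_#|T|) : nat := tag (enum_val a).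

Definition concat_part (c : 'rV[K]_#|T|) d : S :=
  \sum_k c 0 (enum_rank (existT (fun d => 'I_(r d)) d k)) *: e d k.

Lemma basis_comb_concat (c : 'rV[K]_#|T|) :
  basis_comb concat_col c = \sum_d concat_part c d.
Proof.
pose F (t : T) := c 0 (enum_rank t) *: e (tag t) (tagged t).
rewrite -(big_tagged_enum_val _ F); apply: eq_bigr => a _.
by rewrite mxE /F enum_valK.
Qed.

Lemma concat_part_homog c d : concat_part c d \is d.-homog.
Proof. by apply: rpred_sum => k _; apply/rpredZ/e_homog. Qed.

Lemma concat_graded_basis : graded_basis concat_col concat_deg.
Proof.
have [idI pihomogI] := homI.
split=> [a|c Ic|p]; first by rewrite mxE; apply: e_homog.
- apply/rowP=> a; rewrite mxE -(enum_valK a); case: (enum_val a) => d k /=.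
  apply: (e_free (c := fun k => c 0 (enum_rank (existT _ d k)))).
  have := pihomogI _ d Ic; rewrite basis_comb_concat linear_sum (bigD1 d) //=.
  rewrite (pihomog_dE (concat_part_homog c d)) big1 ?addr0 // => d' dd'.
  by rewrite (pihomog_ne0 _ (concat_part_homog c d')).
have /fin_all_exists [c cP] : forall d : 'I_N, exists c : 'I_(r d) -> K,
    I (pihomog mdeg d p - \sum_k c k *: e d k).
  by move=> d; apply: e_span; apply: pihomogP.
pose row_c : 'rV_#|T| := \row_a c (tag (enum_val a)) (tagged (enum_val a)).
exists row_c.
have -> : basis_comb concat_col row_c = \sum_d \sum_k c d k *: e d k.
  rewrite basis_comb_concat; apply: eq_bigr => d _; apply: eq_bigr => k _.
  by rewrite mxE enum_rankK.
rewrite -(subrK (\sum_(d < N) pihomog mdeg d p) p) -addrA; apply: (idealD idI).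
  exact: ideal_sub_pihomog.
by rewrite -sumrB; apply: (ideal_sum idI).
Qed.

Lemma card_concat_deg d :
  #|[set a | concat_deg a == d]| = \sum_(d' < N | d' == d :> nat) r d'.
Proof.
pose F (t : T) := nat_of_bool (tag t == d :> nat).
rewrite -sum1_card big_mkcond /= (eq_bigr (fun a => F (enum_val a))) => [|a _].
  rewrite (big_tagged_enum_val _ F) [RHS]big_mkcond; apply: eq_bigr => d' _.
  transitivity (\sum_(k < r d') (d' == d :> nat))%N; first by [].
  rewrite sum_nat_const card_ord.
  by case: eqP; rewrite ?muln1 ?muln0.
by rewrite inE /F; case: eqP.
Qed.

End Concatenation.

Lemma graded_basis_exists (h : seq nat) :
  is_homog_ideal I -> has_H_vector I h ->
  exists m (E : 'cV[S]_m) (dgE : 'I_m -> nat),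
    graded_basis E dgE /\ forall d, #|[set a | dgE a == d]| = nth 0%N h d.
Proof.
move=> homI [_ dims]; pose r (d : 'I_(size h)) := nth 0%N h d.
have /fin_all_exists [e eP] (d : 'I_(size h)) : exists e : 'I_(r d) -> S,
    [/\ forall k, e k \is d.-homog,
        forall c, I (\sum_k c k *: e k) -> forall k, c k = 0 &
        forall p, p \is d.-homog -> exists c, I (p - \sum_k c k *: e k)].
  exact: dims.
exists _, (concat_col e), (@concat_deg _ r); split=> [|d].
  apply: concat_graded_basis => // [d k|d|d|d p hd homp].
  - by case: (eP d).
  - by case: (eP d).
  - by case: (eP d).
  - by have := dims d; rewrite nth_default // => /has_dim_mod0; apply.
rewrite card_concat_deg; have [dh|hd] := ltnP d (size h).
  by rewrite (big_pred1 (Ordinal dh)).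
rewrite nth_default // big1 // => d' /eqP dd'.
by have := ltn_ord d'; rewrite dd' ltnNge hd.
Qed.

End GradedBasis.

Section KoszulResolution.
Variables (n : nat) (K : fieldType) (I : {mpoly K[n]} -> Prop).
Hypothesis charK : [pchar K] =i pred0.
Hypothesis idI : is_ideal I.
Local Notation S := {mpoly K[n]}.
Variables (m : nat) (E : 'cV[S]_m) (dgE : 'I_m -> nat) (M : 'I_n -> 'M[K]_m).

Definition polyC_mx q r (A : 'M[K]_(q, r)) : 'M[S]_(q, r) :=
  map_mx (@mpolyC n K) A.

Definition shift_mx i : 'M[S]_m := ('X_i)%:M - polyC_mx (M i).

Hypothesis basisE : graded_basis I E dgE.
Hypothesis M_degree : forall i a b, M i a b != 0 -> dgE b = (dgE a).+1.
Hypothesis E_mulX : forall i a, I ('X_i * E a 0 - basis_comb E (row a (M i))).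

Let E_homog a : E a 0 \is (dgE a).-homog.
Proof. by case: basisE. Qed.

Let mul_polyC_mx (c : 'rV[K]_m) a b : (polyC_mx c *m E) a b = basis_comb E c.
Proof.
rewrite (ord1 a) (ord1 b) mxE; apply: eq_bigr => k _.
by rewrite mxE mul_mpolyC.
Qed.

Let E_free (c : 'rV[K]_m) : ideal_mx I (polyC_mx c *m E) -> c = 0.
Proof.
by case: basisE => _ free _ /(_ 0 0); rewrite mul_polyC_mx; apply: free.
Qed.

Let E_shift i : ideal_mx I (shift_mx i *m E).
Proof.
move=> a b; rewrite (ord1 b) /shift_mx mulmxBl mul_scalar_mx !mxE.
have := E_mulX i a; congr (I (_ - _)); apply: eq_bigr => k _.
by rewrite !mxE mul_mpolyC.
Qed.

Local Notation shift_op := (mulmxr_op shift_mx).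

Definition deriv_op i : {additive 'rV[S]_m -> 'rV[S]_m} := map_mx (mderiv i).

Lemma shift_mx_commutator i k :
  shift_mx i *m shift_mx k - shift_mx k *m shift_mx i =
  polyC_mx (M i *m M k - M k *m M i).
Proof.
rewrite /polyC_mx map_mxB !map_mxM /shift_mx !mulmxBl !mulmxBr.
rewrite !mul_scalar_mx !mul_mx_scalar !scale_scalar_mx ['X_k * _]mulrC.
move: (_%:M) (_ *: polyC_mx _) (_ *: polyC_mx _) => X B A.
move: (polyC_mx _ *m _) (polyC_mx _ *m _) => AB BA.
by apply/matrixP=> a b; rewrite !mxE; ring.
Qed.

Lemma shift_mx_comm i k :
  shift_mx i *m shift_mx k = shift_mx k *m shift_mx i.
Proof.
apply/eqP; rewrite -subr_eq0 shift_mx_commutator; apply/eqP.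
suff -> : M i *m M k - M k *m M i = 0 by rewrite /polyC_mx map_mx0.
apply/row_matrixP=> a; rewrite row0; apply: E_free.
rewrite /polyC_mx map_row -/(polyC_mx _) -shift_mx_commutator -row_mul.
set C := shift_mx i *m _ - _; have IC : ideal_mx I (C *m E).
  by rewrite mulmxBl -!mulmxA; apply: (ideal_mxB idI); apply: ideal_mulmx.
by move=> ? b; rewrite mxE.
Qed.

Lemma shift_op_comm i k v :
  shift_op i (shift_op k v) = shift_op k (shift_op i v).
Proof. exact: mulmxr_op_comm shift_mx_comm _ _ _. Qed.

Lemma kos_shift_augment u J : ideal_mx I (kos shift_op u J *m E).
Proof.
rewrite /kos mulmx_suml => a b; rewrite summxE; apply: (ideal_sum idI) => i _.
rewrite -scaler_int -scalemxAl mxE -mulmxA; apply: (idealMl idI).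
exact: ideal_mulmx.
Qed.

Lemma shift_opE i v : shift_op i v = 'X_i *: v - v *m polyC_mx (M i).
Proof. by rewrite -mul_mx_scalar -mulmxBr. Qed.

(* The derivations d/dx_i commute with the matrices M_i, hence satisfy the
   canonical commutation relations with x_i - M_i. *)
Lemma deriv_shift i k (v : 'rV[S]_m) :
  deriv_op k (shift_op i v) = shift_op i (deriv_op k v) + v *+ (i == k).
Proof.
have derivM : deriv_op k (v *m polyC_mx (M i)) = deriv_op k v *m polyC_mx (M i).
  apply/rowP=> b; rewrite !mxE [LHS]raddf_sum; apply: eq_bigr => a _.
  by rewrite !mxE /= mulrC mderiv_mulC mulrC.
rewrite !shift_opE raddfB [deriv_op k (v *m _)]derivM addrAC.
congr (_ - _); apply/rowP=> b; rewrite !mxE /= mderivM mderivX mnm1E addrC.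
congr (_ + _); case: eqVneq => [->|_]; last by rewrite scale0r mul0r mulr0n mxE.
rewrite (_ : U_(k) - U_(k) = 0)%MM ?mpolyX0 ?scale1r ?mul1r //.
by apply/mnmP=> j; rewrite mnmBE mnm0E subnn.
Qed.

Definition deg_lt d (v : 'rV[S]_m) : Prop :=
  forall b mon, (d <= mdeg mon)%N -> (v 0 b)@_mon = 0.

Lemma mcoeff_shift_deriv d (v : 'rV[S]_m) b mon : deg_lt d.+1 v ->
  (d <= mdeg mon)%N ->
  ((\sum_i shift_op i (deriv_op i v)) 0 b)@_mon = (v 0 b)@_mon *+ d.
Proof.
move=> v_lt le_d_mon.
have -> : (\sum_i shift_op i (deriv_op i v)) 0 b =
    \sum_i 'X_i * (v 0 b)^`M(i) -
    \sum_i \sum_a (M i a b) *: (v 0 a)^`M(i).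
  rewrite summxE -sumrB; apply: eq_bigr => i _.
  rewrite shift_opE !mxE /=; congr (_ - _).
  by apply: eq_bigr => a _; rewrite !mxE /= mulrC mul_mpolyC.
rewrite mcoeffB mcoeff_euler [X in _ - X]raddf_sum big1 ?subr0 => [|i _] /=.
  have [->//|ne_d] := eqVneq (mdeg mon) d.
  by rewrite v_lt ?mul0rn // ltn_neqAle eq_sym ne_d.
rewrite raddf_sum big1 // => a _ /=.
by rewrite mcoeffZ mcoeff_mderiv v_lt ?mul0rn ?mulr0 // mdegD mdeg1 addn1 ltnS.
Qed.

Lemma deg_lt1_augment_eq0 (v : 'rV[S]_m) :
  deg_lt 1 v -> ideal_mx I (v *m E) -> v = 0.
Proof.
move=> v_const Iv; have vE : v = polyC_mx (\row_a (v 0 a)@_0).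
  apply/rowP=> a; rewrite !mxE; apply/zhomog_const/zhomogP=> mon.
  by rewrite eqz_nat -lt0n; apply: v_const.
by rewrite vE (E_free (c := \row_a _)) -?vE // /polyC_mx map_mx0.
Qed.

Lemma kos_shift_scale (c : nat -> S) (u : {set 'I_n} -> 'rV[S]_m) J :
  kos shift_op (fun J => c #|J| *: u J) J = c #|J|.+1 *: kos shift_op u J.
Proof.
rewrite /kos scaler_sumr; apply: eq_bigr => i iJ.
by rewrite cardsU1 iJ /= -scalemxAl scalerMzr.
Qed.

Lemma kos_shift_deriv_homotopy (v : {set 'I_n} -> 'rV[S]_m) J :
  (forall J, kos shift_op v J = 0) ->
  kos shift_op (kos_wedge deriv_op v) J =
  \sum_i shift_op i (deriv_op i (v J)) + v J *+ #|J|.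
Proof.
move=> cycv; have := @kos_wedge_homotopy _ _ shift_op deriv_op v J.
rewrite [X in _ + X = _]big1 ?addr0 => [|i _]; last first.
  by rewrite cycv raddf0 mul0rz.
move=> -> => [|i k x ik]; last by rewrite deriv_shift (negbTE ik) addr0.
under [X in _ + X]eq_bigr do rewrite deriv_shift eqxx.
rewrite big_split addrA /= sumr_const; congr (_ + _).
by rewrite [RHS](bigID (mem J)) addrC.
Qed.

(* In exterior degree |J| the operator sum_i (x_i - M_i) d/dx_i + |J| acts on
   leading terms of degree d as multiplication by d + |J|, hence the scaling. *)
Lemma kos_shift_reduce d (u : {set 'I_n} -> 'rV[S]_m) :
  (forall J, kos shift_op u J = 0) -> ideal_mx I (u set0 *m E) ->
  (forall J, deg_lt d.+1 (u J)) ->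
  exists w, forall J, deg_lt d (u J - kos shift_op w J).
Proof.
move=> cycu Iu u_lt.
pose v (J : {set 'I_n}) := ((d + #|J|)%:R^-1)%:MP *: u J.
have cycv J : kos shift_op v J = 0.
  by rewrite (kos_shift_scale (fun k => ((d + k)%:R^-1)%:MP)) cycu scaler0.
have v_lt J : deg_lt d.+1 (v J).
  by move=> b mon le_d; rewrite mxE mcoeffCM u_lt ?mulr0.
exists (kos_wedge deriv_op v) => J b mon le_d.
rewrite kos_shift_deriv_homotopy // 2!mxE mcoeffB mxE mcoeffD.
rewrite (mcoeff_shift_deriv _ (v_lt J)) // mulmxnE mcoeffMn -mulrnDr.
have [dJ0|dJ] := eqVneq (d + #|J|)%N 0%N.
  move: dJ0 => /eqP; rewrite addn_eq0 cards_eq0 => /andP[/eqP d0 /eqP J0].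
  have uJ : u J = 0.
    rewrite J0; apply: deg_lt1_augment_eq0 => //.
    by have := u_lt set0; rewrite d0.
  by rewrite mxE uJ mxE mulr0 mcoeff0 mul0rn subrr.
rewrite mxE mcoeffCM -mulrnAl -[_^-1 *+ _]mulr_natl mulfV ?mul1r ?subrr //.
by rewrite natr_neq0 // lt0n.
Qed.

Lemma kos_shift_exact (u : {set 'I_n} -> 'rV[S]_m) :
  (forall J, kos shift_op u J = 0) -> ideal_mx I (u set0 *m E) ->
  exists w, forall J, u J = kos shift_op w J.
Proof.
have : exists d, forall J, deg_lt d (u J).
  exists (\max_J \max_b msize (u J 0%R b)) => J b mon le_mon.
  apply/memN_msupp_eq0/msize_mdeg_ge/(leq_trans _ le_mon).
  by apply: leq_trans (leq_bigmax J); apply: (leq_bigmax b).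
case=> d; elim: d u => [|d IHd] u u_lt cycu Iu.
  exists (fun=> 0) => J; rewrite kos0; apply/rowP=> b; apply/mpolyP=> mon.
  by rewrite u_lt // mxE mcoeff0.
have [w w_lt] := kos_shift_reduce cycu Iu u_lt.
have [||w' w'E] := IHd (fun J => u J - kos shift_op w J) w_lt.
- by move=> J; rewrite kosB cycu (kos_kos _ _ shift_op_comm) subr0.
- by rewrite mulmxBl; apply: (ideal_mxB idI) => //; apply: kos_shift_augment.
by exists (fun J => w' J + w J) => J; rewrite kosD -w'E subrK.
Qed.

Definition kos_hd (x : kos_basis n m) : nat := #|x.1|.

Definition kos_dg (x : kos_basis n m) : int := (#|x.1| + dgE x.2)%:Z.

Definition kos_aug (x : kos_basis n m) : S := E x.2 0 *+ (x.1 == set0).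

Lemma lincomb_kos_aug (v : kos_basis n m -> S) :
  lincomb setT v kos_aug = ((\row_b v (set0, b)) *m E) 0 0.
Proof.
rewrite /lincomb (eq_bigl xpredT) => [|x]; last exact: in_setT.
rewrite (eq_bigr (fun x => v (x.1, x.2) * kos_aug (x.1, x.2))) => [|[]//].
rewrite -(pair_bigA _ (fun J a => v (J, a) * kos_aug (J, a))) (bigD1 set0) //=.
rewrite [X in _ + X]big1 ?addr0 => [|J /negbTE J0].
  by rewrite mxE; apply: eq_bigr => b _; rewrite mxE /kos_aug eqxx.
by rewrite big1 // => b _; rewrite /kos_aug /= J0 mulr0.
Qed.

Lemma kos_entry_homog x y :
  zhomog (kos_dg x - kos_dg y) (kos_entry shift_mx x y).
Proof.
apply: zhomog_sum => i /andP[iy /eqP xy]; apply: zhomogMz.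
have -> : kos_dg x - kos_dg y = 1 + (dgE x.2)%:Z - (dgE y.2)%:Z.
  rewrite /kos_dg xy cardsU1 iy; lia.
rewrite /shift_mx !mxE; apply: zhomogB.
  case: eqP => [->|_]; last exact: zhomog0.
  by rewrite addrK; apply: zhomogX.
have [->|/M_degree ->] := eqVneq (M i x.2 y.2) 0.
  by rewrite mpolyC0; apply: zhomog0.
by rewrite (_ : _ - _ = 0); [apply: zhomogC | lia].
Qed.

Lemma koszul_resolution :
  based_res I kos_hd kos_dg setT (kos_entry shift_mx) kos_aug.
Proof.
have row_boundary v J :
    \row_b boundary setT (kos_entry shift_mx) v (J, b) =
    kos shift_op (fun J => \row_a v (J, a)) J.
  by apply/rowP=> b; rewrite mxE boundary_kos.
split=> [x y hxy|x|x y|x|v [J b] _|v|p|v cycv].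
- rewrite /kos_entry big1 // => i /andP[iy /eqP xy].
  by rewrite /kos_hd xy cardsU1 iy eqxx in hxy.
- by rewrite /kos_hd /kos_aug cards_eq0 => /negbTE ->.
- exact: kos_entry_homog.
- rewrite /kos_aug /kos_dg; case: eqP => [->|_]; last exact: zhomog0.
  by rewrite cards0; apply/zhomog_dhomog/E_homog.
- rewrite boundary_kos (eq_kos _ _ (row_boundary v)).
  by rewrite (kos_kos _ _ shift_op_comm) mxE.
- by rewrite lincomb_kos_aug row_boundary; apply: kos_shift_augment.
- have [_ _ /(_ p)[c Ic]] := basisE; exists (fun x => (c 0 x.2)%:MP).
  rewrite lincomb_kos_aug (_ : \row_b _ = polyC_mx c) ?mul_polyC_mx //.
  by apply/rowP=> b; rewrite !mxE.
rewrite lincomb_kos_aug => Iv.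
have [J||w wE] := @kos_shift_exact (fun J => \row_a v (J, a)).
- by apply/rowP=> b; rewrite -(boundary_kos _ v (J, b)) cycv ?mxE ?inE.
- by move=> a b; rewrite (ord1 a) (ord1 b).
have row_w J : \row_a w J 0 a = w J by apply/rowP=> a; rewrite mxE.
exists (fun x => w x.1 0 x.2) => -[J b] _.
by rewrite boundary_kos /= (eq_kos _ _ row_w) -wE mxE.
Qed.

End KoszulResolution.

(** * Betti numbers as Koszul homology *)

Section KoszulHomology.
Variables (n : nat) (K : fieldType) (I : {mpoly K[n]} -> Prop).
Local Notation S := {mpoly K[n]}.

Definition mulX i : {additive S -> S} := 'X_i \*o idfun.

(* H_i(x_1, ..., x_n; S/I) vanishes in internal degree i + d. *)
Definition koszul_acyclic (i d : nat) : Prop :=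
  forall p : {set 'I_n} -> S,
    (forall J, p J \is d.-homog) ->
    (forall J : {set 'I_n}, #|J| != i -> p J = 0) ->
    (forall J, I (kos mulX p J)) -> exists q, forall J, I (p J - kos mulX q J).

Lemma ideal_kos_mulX p J :
  is_ideal I -> (forall J, I (p J)) -> I (kos mulX p J).
Proof.
move=> idI Ip; apply: (ideal_sum idI) => i _.
exact/(idealMz idI)/(idealMl idI)/Ip.
Qed.

Hypothesis charK : [pchar K] =i pred0.
Hypothesis homI : is_homog_ideal I.

Let idI : is_ideal I := homI.1.

Section GradedBasisBetti.
Variables (m : nat) (E : 'cV[S]_m) (dgE : 'I_m -> nat).
Hypothesis basisE : graded_basis I E dgE.

Lemma multiplication_matrices : exists M : 'I_n -> 'M[K]_m,
  (forall i a b, M i a b != 0 -> dgE b = (dgE a).+1) /\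
  forall i a, I ('X_i * E a 0 - basis_comb E (row a (M i))).
Proof.
have [E_homog _ E_span] := basisE.
have /fin_all_exists [c cP] : forall ia : 'I_n * 'I_m, exists c,
    I ('X_(ia.1) * E ia.2 0 - basis_comb E c) by move=> ia; apply: E_span.
exists (fun i => \matrix_(a, b) (c (i, a) 0 b *+ (dgE b == (dgE a).+1))).
split=> [i a b|i a].
  by rewrite mxE; have [//|_] := eqVneq (dgE b); rewrite mulr0n eqxx.
have := homog_ideal_zpart (dgE a).+1%:Z homI (cP (i, a)).
rewrite raddfB /= (zpart_dhomog _ (dhomogXM i (E_homog a))) eqxx mulr1n.
rewrite [zpart _ (\sum_b _)]raddf_sum; congr (I (_ - _)).
apply: eq_bigr => b _; rewrite !mxE /= linearZ /= (zpart_dhomog _ (E_homog b)).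
by rewrite eqz_nat; case: eqP => _; rewrite ?mulr1n ?mulr0n ?scaler0 ?scale0r.
Qed.

Variable M : 'I_n -> 'M[K]_m.
Hypothesis M_degree : forall i a b, M i a b != 0 -> dgE b = (dgE a).+1.
Hypothesis E_mulX : forall i a, I ('X_i * E a 0 - basis_comb E (row a (M i))).

Let G_res := koszul_resolution charK idI basisE M_degree E_mulX.

Lemma mcoeff0_kos_entry x y :
  (kos_entry (shift_mx M) x y)@_0 = kos_entry (fun i => - M i) x y.
Proof.
rewrite /kos_entry raddf_sum; apply: eq_bigr => i _ /=.
rewrite raddfMz /= !mxE mcoeffB mcoeffC eqxx mulr1 mcoeffMn mcoeffX.
by rewrite -mdeg_eq0 mdeg1 mul0rn sub0r.
Qed.

Lemma kos_mulX_basis_comb (z : {set 'I_n} -> 'rV[K]_m) J :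
  I (kos mulX (fun J => basis_comb E (z J)) J +
     basis_comb E (kos (mulmxr_op (fun i => - M i)) z J)).
Proof.
rewrite raddf_sum -big_split; apply: (ideal_sum idI) => i _ /=.
rewrite raddfMz -mulrzDl; apply: (idealMz idI); rewrite /= mulmxN raddfN /=.
rewrite mulmx_sum_row [basis_comb E (\sum_a _)]raddf_sum {1}/basis_comb.
rewrite mulr_sumr -sumrB.
apply: (ideal_sum idI) => a _ /=; rewrite linearZ -scalerAr -scalerBr.
exact/(idealZ idI)/E_mulX.
Qed.

Lemma koszul_acyclic_coordinates i d (z : {set 'I_n} -> 'rV[K]_m) :
  koszul_acyclic i d ->
  (forall J b, z J 0 b != 0 -> #|J| = i /\ dgE b = d) ->
  (forall J, kos (mulmxr_op (fun i => - M i)) z J = 0) ->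
  exists w, forall J, z J = kos (mulmxr_op (fun i => - M i)) w J.
Proof.
have [E_homog E_free E_span] := basisE; move=> acyclic z_deg cycz.
have [J|J Ji|J|q Iq] := acyclic (fun J => basis_comb E (z J)).
- apply: rpred_sum => b _; have [->|/z_deg[_ <-]] := eqVneq (z J 0 b) 0.
    by rewrite scale0r rpred0.
  exact/rpredZ/E_homog.
- rewrite (_ : z J = 0) ?raddf0 //; apply/rowP=> b; rewrite mxE.
  by apply/eqP; apply: contraNT Ji => /z_deg[-> _].
- by have := kos_mulX_basis_comb z J; rewrite cycz raddf0 addr0.
have /fin_all_exists [w Iw] J : exists w, I (q J + basis_comb E w).
  have [w Iw] := E_span (- q J); exists w.
  by have := idealN idI Iw; rewrite opprB opprK addrC.
exists w => J; apply/eqP; rewrite -subr_eq0; apply/eqP/E_free; rewrite raddfB.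
have Iqw := ideal_kos_mulX J idI Iw; rewrite kosD in Iqw.
have := idealB idI (idealD idI (Iq J) Iqw) (kos_mulX_basis_comb w J).
by congr I; rewrite addrA subrK opprD addrA addrK.
Qed.

Lemma koszul_acyclic_betti_eq0 F i d :
  minimal_graded_free_resolution I F -> koszul_acyclic i d ->
  gf_betti F i (i + d)%N%:Z = 0%N.
Proof.
move=> minF acyclic; apply: (based_betti_eq0 homI G_res minF) => z z_deg cycz.
have eq_boundary v y :
    boundary setT (fun x y => (kos_entry (shift_mx M) x y)@_0) v y =
    boundary setT (kos_entry (fun i => - M i)) v y.
  by apply: eq_bigr => x _; rewrite mcoeff0_kos_entry.
pose row_z J := \row_b z (J, b).
have [J b||w zE] := @koszul_acyclic_coordinates i d row_z acyclic.
- by rewrite mxE => /z_deg[/= <-]; rewrite /kos_dg /= => -[] /addnI.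
- move=> J; apply/rowP=> b.
  by rewrite -(boundary_kos _ z (J, b)) -eq_boundary cycz ?mxE ?inE.
have row_w J : \row_a w J 0 a = w J by apply/rowP=> b; rewrite mxE.
exists (fun x => w x.1 0 x.2) => -[J b] _; rewrite eq_boundary boundary_kos /=.
by rewrite (eq_kos _ _ row_w) -zE mxE.
Qed.

Lemma card_kos_basis i d :
  #|[set x in [set: kos_basis n m] |
      (kos_hd x == i) && (kos_dg dgE x == (i + d)%N%:Z)]| =
  ('C(n, i) * #|[set b | dgE b == d]|)%N.
Proof.
have <- : #|[set J : {set 'I_n} | #|J| == i]| = 'C(n, i).
  by rewrite card_draws card_ord.
rewrite -cardsX; apply: eq_card => -[J b]; rewrite !inE /kos_hd /kos_dg /=.
by case: eqP => //= ->; rewrite eqz_nat eqn_add2l.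
Qed.

Lemma card_kos_basis0 i (j : int) : (forall d : nat, j <> (i + d)%N%:Z) ->
  #|[set x in [set: kos_basis n m] | (kos_hd x == i) && (kos_dg dgE x == j)]|
  = 0%N.
Proof.
move=> j_low; apply: eq_card0 => -[J b]; rewrite !inE /kos_hd /kos_dg /=.
by case: eqP => //= ->; apply/negP=> /eqP/esym/j_low.
Qed.

End GradedBasisBetti.

(* rho i d is the rank of the Koszul differential of S/I from homological degree
   i to i - 1 and from internal degree d of S/I to d + 1. *)
Theorem koszul_betti (h : seq nat) : has_H_vector I h ->
  (exists F, minimal_graded_free_resolution I F) /\
  exists2 rho : nat -> nat -> nat, forall d, rho 0%N d = 0%N &
    forall F, minimal_graded_free_resolution I F ->
    [/\ forall i d, (gf_betti F i (i + d)%N%:Z +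
             (if d is d'.+1 then rho i.+1 d' else 0) + rho i d =
             'C(n, i) * nth 0 h d)%N,
        forall i (j : int), (forall d : nat, j <> (i + d)%N%:Z) ->
          gf_betti F i j = 0%N &
        forall i d, koszul_acyclic i d -> gf_betti F i (i + d)%N%:Z = 0%N].
Proof.
case/(graded_basis_exists homI) => m [E [dgE [basisE cardE]]].
have [M [M_degree E_mulX]] := multiplication_matrices basisE.
have res := koszul_resolution charK idI basisE M_degree E_mulX.
pose G := gf_of (@kos_hd n m) (@kos_dg n m dgE) setT (kos_entry (shift_mx M))
  (kos_aug E).
split; first exact: (based_res_minimal_resolution homI res).
exists (fun i d => strand_rank G i (i + d)%N%:Z) => [d|F minF].
  by apply/eqP; rewrite -leqn0 (leq_trans (mxrankM_maxr _ _)) // rank_leq_col.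
have strands i j := gf_betti_strand homI minF (gf_of_graded res)
  (gf_of_resolves homI res) i j.
rewrite -/G in strands.
have bettiG i j : gf_betti G i j =
    #|[set x in [set: kos_basis n m] | (kos_hd x == i) && (kos_dg dgE x == j)]|.
  exact: gf_betti_of.
split=> [i d|i j j_low|i d].
- rewrite -cardE -card_kos_basis -bettiG -strands.
  congr (_ + _ + _)%N; case: d => [|d]; last by rewrite addSnnS.
  have := strands i.+1 (i + 0)%N%:Z.
  rewrite bettiG card_kos_basis0; first by lia.
  by move=> d /eqP; rewrite eqz_nat; lia.
- have := strands i j; rewrite bettiG card_kos_basis0 //; lia.
- exact: (koszul_acyclic_betti_eq0 basisE M_degree E_mulX minF).
Qed.

End KoszulHomology.

(** * Multiplication by linear forms *)

Section DimensionModulo.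
Variables (n : nat) (K : fieldType) (I : {mpoly K[n]} -> Prop).
Hypothesis idI : is_ideal I.
Local Notation S := {mpoly K[n]}.
Local Notation kosX := (kos (@mulX n K)).
Implicit Types V : S -> Prop.

Definition free_mod r (E : 'cV[S]_r) : Prop :=
  forall c, I (basis_comb E c) -> c = 0.

Definition spans_mod V r (E : 'cV[S]_r) : Prop :=
  forall p, V p -> exists c, I (p - basis_comb E c).

Lemma has_dim_modP V r : has_dim_mod V I r ->
  exists E : 'cV[S]_r, [/\ forall k, V (E k 0), free_mod E & spans_mod V E].
Proof.
case=> e [Ve free_e span_e].
exists (\col_k e k); split=> [k|c Ic|p /span_e[c Ic]].
- by rewrite mxE.
- apply/rowP=> k; rewrite mxE; apply: (free_e (fun k => c 0 k)).
  by move: Ic; congr I; apply: eq_bigr => l _; rewrite mxE.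
- exists (\row_k c k); move: Ic; congr (I (_ - _)).
  by apply: eq_bigr => l _; rewrite !mxE.
Qed.

Lemma coordinate_mx V r s (E : 'cV[S]_r) (F : 'cV[S]_s) :
  spans_mod V E -> (forall k, V (F k 0)) ->
  exists C : 'M[K]_(s, r), forall u, I (basis_comb F u - basis_comb E (u *m C)).
Proof.
move=> spanE VF.
have /fin_all_exists [c cP] k : exists c, I (F k 0 - basis_comb E c).
  by apply: spanE.
exists (\matrix_k c k) => u.
rewrite mulmx_sum_row [basis_comb E (\sum_k _)]raddf_sum {1}/basis_comb -sumrB.
apply: (ideal_sum idI) => k _ /=; rewrite linearZ rowK -scalerBr.
exact/(idealZ idI)/cP.
Qed.

Lemma free_mod_spans V r (F : 'cV[S]_r) :
  has_dim_mod V I r -> (forall k, V (F k 0)) -> free_mod F -> spans_mod V F.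
Proof.
move=> /has_dim_modP[E [_ _ spanE]] VF freeF p /spanE[c Ic].
have [C CP] := coordinate_mx spanE VF.
have C_unit : C \in unitmx.
  rewrite -row_free_unit -kermx_eq0; apply/rowV0P=> u /sub_kermxP uC.
  by apply: freeF; have := CP u; rewrite uC raddf0 subr0.
exists (c *m invmx C); have := idealB idI Ic (CP (c *m invmx C)).
by rewrite mulmxKV // opprB addrA subrK.
Qed.

Lemma spans_mod_free V r (F : 'cV[S]_r) :
  has_dim_mod V I r -> (forall k, V (F k 0)) -> spans_mod V F -> free_mod F.
Proof.
move=> /has_dim_modP[E [VE freeE spanE]] VF spanF u Iu.
have [C CP] := coordinate_mx spanE VF; have [U UP] := coordinate_mx spanF VE.
have UC : U *m C = 1%:M.
  apply/row_matrixP=> k; apply/eqP; rewrite -subr_eq0; apply/eqP/freeE.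
  rewrite rowE raddfB /= mulmxA row1 -rowE.
  have := idealD idI (UP (delta_mx 0 k)) (CP (delta_mx 0 k *m U)).
  by rewrite addrA subrK -rowE => /(idealN idI); rewrite opprB.
have uC : u *m C = 0.
  apply: freeE; rewrite -[basis_comb _ _](subKr (basis_comb F u)).
  exact: idealB.
by rewrite -[u]mulmx1 -(mulmx1C UC) mulmxA uC mul0mx.
Qed.

Lemma dim_mod_dependent V r (F : 'cV[S]_r.+1) :
  has_dim_mod V I r -> (forall k, V (F k 0)) ->
  exists2 u, u != 0 & I (basis_comb F u).
Proof.
move=> /has_dim_modP[E [_ _ spanE]] VF; have [C CP] := coordinate_mx spanE VF.
have : ~~ row_free C by rewrite /row_free neq_ltn ltnS rank_leq_col.
rewrite -kermx_eq0 => /rowV0Pn[u /sub_kermxP uC u0].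
by exists u => //; have := CP u; rewrite uC raddf0 subr0.
Qed.

Lemma basis_comb_homog d r (E : 'cV[S]_r) c :
  (forall k, E k 0 \is d.-homog) -> basis_comb E c \is d.-homog.
Proof. by move=> homE; apply: rpred_sum => k _; apply: rpredZ. Qed.

Lemma basis_combMl l r (E : 'cV[S]_r) c :
  basis_comb (l *: E) c = l * basis_comb E c.
Proof. by rewrite mulr_sumr; apply: eq_bigr => k _; rewrite mxE scalerAr. Qed.

Definition has_dim_homog d r : Prop :=
  has_dim_mod (fun p => p \is d.-homog) I r.

Definition mul_inj_on l d : Prop :=
  forall p, p \is d.-homog -> I (l * p) -> I p.

Definition mul_surj_on l d e : Prop :=
  forall q, q \is e.-homog -> exists2 p, p \is d.-homog & I (q - l * p).

Section EqualDimensions.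
Variables (k d r : nat) (l : S).
Hypothesis l_homog : l \is k.-homog.
Hypothesis dim_d : has_dim_homog d r.
Hypothesis dim_kd : has_dim_homog (k + d) r.

Lemma mul_inj_surj : mul_inj_on l d -> mul_surj_on l d (k + d).
Proof.
have [E [homE freeE _]] := has_dim_modP dim_d; move=> injl q homq.
have [|c Ic|c Ic] := @free_mod_spans _ _ (l *: E) dim_kd _ _ q homq.
- by move=> a; rewrite mxE dhomogM.
- apply/freeE/injl; first exact: basis_comb_homog.
  by rewrite -basis_combMl.
exists (basis_comb E c); first exact: basis_comb_homog.
by rewrite -basis_combMl.
Qed.

Lemma mul_surj_inj : mul_surj_on l d (k + d) -> mul_inj_on l d.
Proof.
have [E [homE _ spanE]] := has_dim_modP dim_d; move=> surjl p homp Ilp.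
have [c Ic] := spanE p homp.
have freeL : free_mod (l *: E).
  apply: (spans_mod_free dim_kd) => [a|q /surjl[p' /spanE[c' Ic'] Iq]].
    by rewrite mxE dhomogM.
  exists c'; rewrite basis_combMl; have := idealD idI Iq (idealMl idI l Ic').
  by rewrite mulrBr addrA subrK.
apply: (ideal_subr_trans idI Ic).
rewrite (freeL c) ?raddf0; first exact: ideal0.
have := idealB idI Ilp (idealMl idI l Ic).
by rewrite basis_combMl mulrBr subKr.
Qed.

End EqualDimensions.

Hypothesis charK : [pchar K] =i pred0.

Lemma mul_surj_onS l d e : mul_surj_on l d e -> mul_surj_on l d.+1 e.+1.
Proof.
move=> surjl q /(homog_split charK)[u homu ->].
have /fin_all_exists2 [v homv Iv] i :
    exists2 p, p \is d.-homog & I (u i - l * p) by apply: surjl.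
exists (\sum_i 'X_i * v i).
  by apply: rpred_sum => i _; apply: dhomogXM.
rewrite mulr_sumr -sumrB; apply: (ideal_sum idI) => i _.
by rewrite mulrCA -mulrBr; apply: idealMl.
Qed.

Definition linear_form (lam : 'I_n -> K) : S := \sum_i lam i *: 'X_i.

Lemma linear_form_exists l :
  l \is 1.-homog -> exists lam, l = linear_form lam.
Proof.
case/(homog_split charK)=> u homu ->; exists (fun i => (u i)@_0).
apply: eq_bigr => i _; rewrite -mul_mpolyC mulrC; congr (_ * _).
exact/zhomog_const/zhomog_dhomog.
Qed.

Definition scale_op (lam : 'I_n -> K) i : {additive S -> S} := *:%R (lam i).

(* A linear form is null-homotopic on the Koszul complex of x_1, ..., x_n. *)
Lemma kos_wedge_scale lam (q : {set 'I_n} -> S) J :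
  kosX (kos_wedge (scale_op lam) q) J +
  kos_wedge (scale_op lam) (kosX q) J = linear_form lam * q J.
Proof.
rewrite kos_wedge_homotopy => [|i k v _]; last by rewrite /= scalerAr.
rewrite /linear_form mulr_suml [RHS](bigID (mem J)) [RHS]addrC /=.
by congr (_ + _); apply: eq_bigr => i _; rewrite -scalerAl ?scalerAr.
Qed.

Lemma kos_mulX_Ml a (p : {set 'I_n} -> S) J :
  kosX (fun J => a * p J) J = a * kosX p J.
Proof.
by rewrite mulr_sumr; apply: eq_bigr => i _ /=; rewrite mulrzAr mulrCA.
Qed.

Lemma koszul_acyclic_bij l d i : l \is 1.-homog ->
  mul_surj_on l d d.+1 -> mul_inj_on l d.+1 -> koszul_acyclic I i d.+1.
Proof.
move=> /linear_form_exists[lam ->] surjl injl p homp _ cycp.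
have /fin_all_exists2 [q homq Iq] J :
    exists2 q, q \is d.-homog & I (p J - linear_form lam * q) by apply: surjl.
have cycq J : I (kosX q J).
  apply: injl.
    by apply: rpred_sum => k _; apply/rpredMz/dhomogXM/homq.
  rewrite -kos_mulX_Ml; apply: (ideal_subr_trans idI _ (cycp J)).
  rewrite -opprB -kosB; apply: (idealN idI); exact: ideal_kos_mulX.
exists (kos_wedge (scale_op lam) q) => J.
have Iw : I (kos_wedge (scale_op lam) (kosX q) J).
  by apply: (ideal_sum idI) => k _; apply/(idealMz idI)/(idealZ idI).
have := idealD idI (Iq J) Iw.
by rewrite -kos_wedge_scale opprD addrA subrK.
Qed.

End DimensionModulo.

(** * Injective linear forms *)

Lemma natr_inj (K : fieldType) :
  [pchar K] =i pred0 -> injective (fun k => k%:R : K).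
Proof.
move=> charK i j; wlog le_ij : i j / (i <= j)%N => [sym|] /= eq_ij.
  by case: (leqP i j) => [/sym->//|/ltnW/sym->].
apply/eqP; rewrite eqn_leq le_ij /= -subn_eq0 -((pcharf0P K).1 charK) natrB //.
by rewrite eq_ij subrr.
Qed.

Section Polarization.
Variables (R : comPzRingType) (r : nat).

Lemma prod_natr_bool (I : finType) (P Q : pred I) :
  \prod_(i | P i) (Q i)%:R = [forall (i | P i), Q i]%:R :> R.
Proof.
rewrite -big_andE; elim/big_rec2: _ => [//|i b x _ ->].
by rewrite -natrM mulnb.
Qed.

Lemma injectiveb_onto (I : finType) (f : I -> I) :
  injectiveb f = [forall i, i \in f @: setT].
Proof.
apply/injectiveP/forallP=> [injf i|onto].
  have /eqP -> : f @: setT == setT by rewrite eqEcard subsetT card_imset /=.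
  by rewrite inE.
have /imset_injP injf : #|f @: setT| == #|[set: I]|.
  by apply/eqP/eq_card => i; rewrite onto inE.
by move=> i j; apply: injf; rewrite inE.
Qed.

Lemma sum_sign_image (f : 'I_r -> 'I_r) :
  \sum_(J : {set 'I_r}) (-1) ^+ #|~: J| * \prod_k (f k \in J)%:R =
  (injectiveb f)%:R :> R.
Proof.
have image_sub (J : {set 'I_r}) : \prod_k (f k \in J)%:R =
    \prod_(i in ~: J) (i \notin f @: setT)%:R :> R.
  rewrite !prod_natr_bool; congr (nat_of_bool _)%:R.
  apply/forall_inP/forall_inP=> fJ i iJ; last first.
    by apply: contraT; rewrite -in_setC => /fJ; rewrite imset_f.
  by apply: contraTN iJ => /imsetP[k _ ->]; rewrite inE negbK fJ.
under eq_bigr do rewrite image_sub -prodr_const -big_split big_mkcond /=.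
transitivity (\prod_(i < r) (1 + - (i \notin f @: setT)%:R) : R).
  rewrite bigA_distr; apply: eq_bigr => J _; apply: eq_bigr => i _.
  by rewrite inE mulN1r; case: (i \in J).
rewrite injectiveb_onto -(prod_natr_bool xpredT (fun i => i \in f @: setT)).
by apply: eq_bigr => i _; case: (i \in _); rewrite ?mulr0n ?subr0 ?subrr.
Qed.

Lemma polarization (x : 'I_r -> R) :
  \sum_(J : {set 'I_r}) (-1) ^+ #|~: J| * (\sum_(i in J) x i) ^+ r =
  r`!%:R * \prod_i x i.
Proof.
have power_sum (J : {set 'I_r}) : (\sum_(i in J) x i) ^+ r =
    \sum_(f : {ffun 'I_r -> 'I_r}) (\prod_k (f k \in J)%:R) * \prod_k x (f k).
  transitivity (\prod_(k < r) \sum_i (if i \in J then x i else 0)).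
    by rewrite prodr_const card_ord big_mkcond.
  rewrite bigA_distr_bigA; apply: eq_bigr => f _.
  rewrite -big_split; apply: eq_bigr => k _ /=.
  by case: ifP; rewrite ?mul1r ?mul0r.
under [LHS]eq_bigr do rewrite power_sum mulr_sumr.
rewrite exchange_big /=.
transitivity (\sum_(f : {ffun 'I_r -> 'I_r} | injectiveb f) \prod_i x i).
  rewrite [RHS]big_mkcond; apply: eq_bigr => f _.
  under eq_bigr do rewrite mulrA.
  rewrite -mulr_suml sum_sign_image.
  case: injectiveP => [injf|]; last by rewrite mul0r.
  by rewrite mul1r [RHS](reindex_inj injf).
by rewrite sumr_const -cardsE card_inj_ffuns card_ord ffactnn mulr_natl.
Qed.

End Polarization.

Section Avoidance.
Variables (T : finType).

Lemma card_bad_points q c (tau : T) (bad : pred {ffun T -> 'I_q.+1}) :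
  (forall g : {ffun T -> 'I_q.+1},
     #|[set t | bad [ffun s => if s == tau then t else g s]]| <= c)%N ->
  (q.+1 * #|bad| <= c * #|{ffun T -> 'I_q.+1}|)%N.
Proof.
move=> bad_line; pose upd (g : {ffun T -> 'I_q.+1}) t : {ffun T -> 'I_q.+1} :=
  [ffun s => if s == tau then t else g s].
have shift_inj t : injective (fun g => upd g (g tau + t)).
  move=> g g' /ffunP eq_upd; apply/ffunP=> s.
  have := eq_upd s; have := eq_upd tau; rewrite !ffunE eqxx => /addIr eq_tau.
  by case: eqP => [->|].
have -> : (q.+1 * #|bad| = \sum_g \sum_t bad (upd g t))%N.
  transitivity (\sum_(t : 'I_q.+1) \sum_g bad (upd g (g tau + t)%R))%N.
    transitivity (\sum_(t : 'I_q.+1) #|bad|)%N.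
      by rewrite sum_nat_const card_ord.
    apply: eq_bigr => t _.
    rewrite -sum1_card big_mkcond /= [LHS](reindex_inj (shift_inj t)) /=.
    by apply: eq_bigr => g _; rewrite unfold_in; case: (bad _).
  rewrite exchange_big; apply: eq_bigr => g _.
  by rewrite [RHS](reindex_inj (addrI (g tau))).
rewrite mulnC -sum_nat_const; apply: leq_sum => g _.
apply: leq_trans (bad_line g); rewrite -sum1_card [X in (_ <= X)%N]big_mkcond.
by apply: leq_sum => t _; rewrite inE; case: (bad _).
Qed.

(* On the grid {0, ..., q}^T each B tau covers at most a fraction c / (q + 1),
   since every line in direction tau meets it in at most c points. *)
Lemma exists_avoiding (K : fieldType) c (B : T -> {ffun T -> K} -> Prop) :
  [pchar K] =i pred0 ->
  (forall tau (g : {ffun T -> K}) (t : 'I_c.+1 -> K), injective t ->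
     exists i, ~ B tau [ffun s => if s == tau then t i else g s]) ->
  exists g, forall tau, ~ B tau g.
Proof.
move=> charK avoid; pose q := (c * #|T|)%N.
pose coerce (g : {ffun T -> 'I_q.+1}) : {ffun T -> K} := [ffun s => (g s)%:R].
pose bad tau g : bool := excluded_middle_informative (B tau (coerce g)).
have badP tau g : reflect (B tau (coerce g)) (bad tau g) by apply: sumboolP.
have bad_few tau : (q.+1 * #|bad tau| <= c * #|{ffun T -> 'I_q.+1}|)%N.
  apply: (@card_bad_points q c tau) => g; rewrite leqNgt; apply/negP=> many.
  pose value i : K := (enum_val (widen_ord many i) : nat)%:R.
  have [|i] := avoid tau (coerce g) value.
    move=> i j /(natr_inj charK)/val_inj/enum_val_inj/(congr1 val) eq_ij.
    exact/val_inj.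
  apply; have := enum_valP (widen_ord many i); rewrite inE => /badP.
  by congr (B tau _); apply/ffunP=> s; rewrite !ffunE; case: eqP.
have few : (\sum_tau #|bad tau| < #|{ffun T -> 'I_q.+1}|)%N.
  rewrite -(ltn_pmul2l (ltn0Sn q)) big_distrr /=.
  apply: (@leq_ltn_trans (\sum_(tau : T) c * #|{ffun T -> 'I_q.+1}|)).
    exact: leq_sum.
  rewrite sum_nat_const mulnA [(#|T| * c)%N]mulnC ltn_pmul2r //.
  by rewrite card_ffun card_ord expn_gt0.
suff /existsP[g /forallP good] : [exists g, [forall tau, ~~ bad tau g]].
  by exists (coerce g) => tau /badP; apply/negP.
apply: contraLR few; rewrite negb_exists -leqNgt => /forallP all_bad.
under eq_bigr do rewrite -sum1_card big_mkcond.
rewrite exchange_big /= -sum1_card; apply: leq_sum => g _.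
have := all_bad g; rewrite negb_forall => /existsP[tau]; rewrite negbK => bad_g.
have {}bad_g : g \in bad tau := bad_g.
by rewrite (bigD1 tau) //= bad_g.
Qed.

End Avoidance.

Section InjectiveLinearForm.
Variables (n : nat) (K : fieldType) (I : {mpoly K[n]} -> Prop).
Hypothesis charK : [pchar K] =i pred0.
Hypothesis idI : is_ideal I.
Local Notation S := {mpoly K[n]}.

Definition socle_free (d : nat) : Prop :=
  forall p, p \is d.-homog -> in_socle I p -> I p.

Lemma socle_free_monomials r d p :
  (forall j, (j < r)%N -> socle_free (d + j)) -> p \is d.-homog ->
  (forall s : r.-tuple 'I_n, I ((\prod_(i <- s) 'X_i) * p)) -> I p.
Proof.
elim: r d p => [|r IHr] d p no_socle homp Isp.
  by have := Isp [tuple]; rewrite big_nil mul1r.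
apply: (no_socle 0%N) => // [|k]; first by rewrite addn0.
apply: (IHr d.+1) => [j jr||s].
- by rewrite addSnnS; apply: no_socle.
- exact: dhomogXM.
- by rewrite mulrCA mulrA; have := Isp [tuple of k :: s]; rewrite big_cons.
Qed.

Lemma prod_add_mod (T : Type) (s : seq T) (P : pred T) (a p : S) (b : T -> S) :
  I (a * p) ->
  I ((\prod_(i <- s | P i) (a + b i) - \prod_(i <- s | P i) b i) * p).
Proof.
move=> Iap; elim/big_rec2: _ => [|i y x _ Ixy] /=.
  by rewrite subrr mul0r; apply: ideal0.
have := idealD idI (idealMl idI x Iap) (idealMl idI (b i) Ixy).
by congr I; ring.
Qed.

Definition unkilled_annihilator d r (y x : S) : Prop :=
  exists m, [/\ m \is d.-homog, I (x * m) & ~ I (y ^+ r * m)].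

(* The r + 1 annihilators m_i of x + t_i y in an r-dimensional space are
   dependent; multiplying a relation by the other x + t_i y leaves y^r m_i = 0
   for some i. *)
Lemma pencil_avoids_unkilled d r (x y : S) (t : 'I_r.+1 -> K) :
  has_dim_homog I d r -> injective t ->
  exists i, ~ unkilled_annihilator d r y (x + t i *: y).
Proof.
move=> dim_d inj_t; apply: NNPP => /not_ex_not_all all_unkilled.
have /fin_all_exists [m mP] := all_unkilled.
have [|u u0 Iu] := dim_mod_dependent (F := \col_i m i) idI dim_d.
  by move=> i; rewrite mxE; case: (mP i).
have /rV0Pn[i0 ui0] := u0; have [homm Ixm ni0] := mP i0; apply: ni0.
pose others := \prod_(i | i != i0) (x + t i *: y).
have Iothers : I (others * m i0).
  have Irest : I (others * \sum_(i | i != i0) u 0 i *: (\col_i m i) i 0).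
    rewrite mulr_sumr; apply: (ideal_sum idI) => i ii0.
    rewrite mxE -scalerAr; apply: (idealZ idI).
    rewrite /others (bigD1 i) //= mulrAC mulrC; apply: (idealMl idI).
    by case: (mP i).
  have := idealB idI (idealMl idI others Iu) Irest.
  rewrite /basis_comb (bigD1 i0) //= -mulrBr addrK mxE -scalerAr.
  exact: idealZ_inj.
have := prod_add_mod (index_enum _) (fun i => i != i0)
  (fun i => (t i - t i0) *: y) Ixm.
rewrite (eq_bigr (fun i => x + t i *: y)) => [|i _]; last first.
  by rewrite -addrA -scalerDl [t i0 + _]addrC subrK.
rewrite mulrBl => /(idealB idI Iothers); rewrite subKr scaler_prod.
rewrite prodr_const cardC1 card_ord -scalerAl; apply: (idealZ_inj idI).
by apply/prodf_neq0 => i ii0; rewrite subr_eq0 (inj_eq inj_t).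
Qed.

Lemma exists_injective_linear_form d r :
  has_dim_homog I d r ->
  (forall j, (j < r)%N -> socle_free (d + j)) ->
  exists2 l, l \is 1.-homog & mul_inj_on I l d.
Proof.
move=> dim_d no_socle; pose T : finType := ({set 'I_r} * r.-tuple 'I_n)%type.
pose y (tau : T) : S := \sum_(i in tau.1) 'X_(tnth tau.2 i).
pose x (g : {ffun T -> K}) : S := \sum_tau g tau *: y tau.
pose bad tau g := unkilled_annihilator d r (y tau) (x g).
have [|g good_g] := @exists_avoiding T K r bad charK.
  move=> tau g t inj_t; pose x' := \sum_(s | s != tau) g s *: y s.
  have [i killed] := pencil_avoids_unkilled x' (y tau) dim_d inj_t.
  exists i; rewrite /bad /x (bigD1 tau) //= ffunE eqxx addrC.
  rewrite (eq_bigr (fun s => g s *: y s)) // => s /negbTE s_tau.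
  by rewrite ffunE s_tau.
exists (x g) => [|m homm Ixm].
  apply: rpred_sum => tau _; apply: rpredZ; apply: rpred_sum => i _.
  by rewrite dhomogX /= mdeg1.
apply: (socle_free_monomials no_socle homm) => s.
apply: (idealZ_inj idI (natr_neq0 charK (fact_gt0 r))).
rewrite big_tuple scalerAl scaler_nat -mulr_natl -polarization mulr_suml.
apply: (ideal_sum idI) => J _; rewrite -mulrA; apply: (idealMl idI).
by apply: NNPP => nI; apply: (good_g (J, s)); exists m.
Qed.

End InjectiveLinearForm.

(** * Vanishing of Koszul homology *)

Section KoszulVanishing.
Variables (n : nat) (K : fieldType) (I : {mpoly K[n]} -> Prop).
Hypothesis idI : is_ideal I.
Local Notation S := {mpoly K[n]}.
Local Notation kosX := (kos (@mulX n K)).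

Lemma kosX_const (c : {set 'I_n} -> K) J :
  kosX (fun J => (c J)%:MP) J =
  \sum_(k | k \notin J) (c (k |: J) *~ kos_sign k J) *: 'X_k.
Proof.
apply: eq_bigr => k _; rewrite /= mulrC mul_mpolyC.
by rewrite scalerMzl.
Qed.

Lemma koszul_acyclic_degree0 i : (0 < i)%N ->
  (forall l, l \is 1.-homog -> I l -> l = 0) -> koszul_acyclic I i 0.
Proof.
move=> i_gt0 no_linear p homp p_deg cycp.
pose c J := (p J)@_0; have pE J : p J = (c J)%:MP.
  exact/zhomog_const/zhomog_dhomog.
suff c0 J : c J = 0.
  exists (fun=> 0) => J; rewrite kos0 pE c0 mpolyC0 subr0; exact: ideal0.
have [Ji|/p_deg pJ] := eqVneq #|J| i; last by rewrite /c pJ mcoeff0.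
have [k kJ] : exists k, k \in J by apply/set0Pn; rewrite -card_gt0 Ji.
have kosE := kosX_const c (J :\ k).
rewrite -(eq_kos _ _ pE) in kosE.
have kos0 : kosX p (J :\ k) = 0.
  apply: no_linear (cycp _); rewrite kosE; apply: rpred_sum => l _.
  by rewrite rpredZ // dhomogX /= mdeg1.
move: kosE; rewrite kos0 => /(congr1 (mcoeff U_(k)%MM)).
rewrite mcoeff0 raddf_sum (bigD1 k) ?setD11 //= big1 => [|l].
  rewrite addr0 mcoeffZ mcoeffXU eqxx mulr1 setD1K //.
  move/(congr1 (fun a => a *~ kos_sign k (J :\ k))).
  by rewrite mul0rz -mulrzA kos_signK.
by case/andP=> _ /negbTE lk; rewrite mcoeffZ mcoeffXU lk mulr0.
Qed.

Lemma koszul_acyclic_hd0 d : [pchar K] =i pred0 -> koszul_acyclic I 0 d.+1.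
Proof.
move=> charK p homp p_deg _; have [u homu pE] := homog_split charK (homp set0).
exists (fun J => \sum_k u k *+ (J == [set k])) => J.
have [->|J0] := eqVneq J set0; last first.
  rewrite p_deg ?cards_eq0 // sub0r; apply/(idealN idI)/(ideal_sum idI) => k kJ.
  apply/(idealMz idI)/(idealMl idI); rewrite big1; first exact: ideal0.
  move=> l _; case: eqP => // /(congr1 (fun A : {set 'I_n} => #|A|)).
  by rewrite cards1 cardsU1 kJ => -[/eqP]; rewrite cards_eq0 (negbTE J0).
rewrite pE (_ : kosX _ _ = \sum_k 'X_k * u k) ?subrr; first exact: ideal0.
apply: eq_big => [k|k _]; first by rewrite inE.
rewrite /= setU0 (bigD1 k) //= eqxx big1 ?addr0 => [|l /negbTE lk].
  rewrite /kos_sign (_ : #|_| = 0%N) ?expr0 //.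
  by apply: eq_card0 => j; rewrite !inE.
by case: eqP => // /set1_inj kl; rewrite kl eqxx in lk.
Qed.

Lemma koszul_acyclic_hd_max d : socle_free I d -> koszul_acyclic I n d.
Proof.
move=> no_socle p homp p_deg cycp; exists (fun=> 0) => J; rewrite kos0 subr0.
have [Jn|/p_deg->] := eqVneq #|J| n; last exact: ideal0.
have -> : J = setT.
  by apply/eqP; rewrite eqEcard subsetT cardsT card_ord Jn leqnn.
apply: no_socle => // k; have := cycp (setT :\ k).
rewrite /kos (bigD1 k) ?setD11 //= setD1K ?inE // big1 => [|l]; last first.
  by rewrite !inE andbT negbK => /andP[->].
rewrite addr0 => /(idealMz idI (kos_sign k (setT :\ k))).
by rewrite -mulrzA kos_signK.
Qed.

Lemma dual_element_boundary (k : 'I_n) (w u : S) (J J' : {set 'I_n}) :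
  k \notin J ->
  (forall l, I ('X_l * u - w *+ (l == k))) ->
  I (w *+ (J' == J) -
     kosX (fun J' => u *+ (J' == k |: J) *~ kos_sign k J) J').
Proof.
move=> kJ uP; have -> : w *+ (J' == J) = \sum_(l | l \notin J')
    (w *+ (l == k)) *+ (l |: J' == k |: J) *~ kos_sign k J *~ kos_sign l J'.
  have [->|J'J] := eqVneq J' J.
    rewrite (bigD1 k) //= !eqxx -mulrzA kos_signK big1 ?addr0 // => l.
    by case/andP=> _ /negbTE->; rewrite mul0rn !mul0rz.
  rewrite big1 // => l lJ'.
  case: (eqVneq l k) => [lk|_]; last by rewrite mul0rn !mul0rz.
  case: eqP => [eqU|_]; last by rewrite !mul0rz.
  by case/eqP: J'J; rewrite -(setU1K lJ') eqU lk setU1K.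
rewrite -sumrB; apply: (ideal_sum idI) => l _; rewrite -mulrzBl.
apply: (idealMz idI); case: (l |: J' == _); last first.
  by rewrite !mulr0n !mul0rz raddf0 subr0; apply: ideal0.
rewrite !mulr1n raddfMz -mulrzBl; apply: (idealMz idI).
by rewrite -opprB; apply/(idealN idI)/uP.
Qed.

Lemma koszul_acyclic_dual i d : (i < n)%N ->
  (forall k w, w \is d.-homog ->
     exists u, forall l, I ('X_l * u - w *+ (l == k))) ->
  koszul_acyclic I i d.
Proof.
move=> i_lt dual p homp p_deg _.
have /fin_all_exists [q qP] (J : {set 'I_n}) : exists q, forall J',
    I (p J *+ (J' == J) - kosX q J').
  have [Ji|/p_deg->] := eqVneq #|J| i; last first.
    by exists (fun=> 0) => J'; rewrite kos0 mul0rn subr0; apply: ideal0.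
  have [k kJ] : exists k, k \notin J.
    have : ~: J != set0 by rewrite -card_gt0 cardsCs setCK card_ord Ji subn_gt0.
    by case/set0Pn=> k; rewrite inE; exists k.
  have [u uP] := dual k (p J) (homp J).
  exists (fun J' => u *+ (J' == k |: J) *~ kos_sign k J) => J'.
  exact: dual_element_boundary.
exists (fun J' => \sum_J q J J') => J'.
rewrite kos_sum -(_ : \sum_J p J *+ (J' == J) = p J').
  by rewrite -sumrB; apply: (ideal_sum idI).
rewrite (bigD1 J') //= eqxx big1 ?addr0 // => J; rewrite eq_sym => /negbTE ->.
by rewrite mulr0n.
Qed.

End KoszulVanishing.

Section SocleAndDuality.
Variables (n : nat) (K : fieldType) (I : {mpoly K[n]} -> Prop).
Hypothesis charK : [pchar K] =i pred0.
Hypothesis homI : is_homog_ideal I.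

Let idI : is_ideal I := homI.1.

Lemma has_dim_mod_neq0 V r :
  has_dim_mod V I r -> r != 0%N -> exists2 p, V p & ~ I p.
Proof.
case: r => // r [e [Ve free_e _]] _; exists (e ord0) => // Ie.
suff /eqP : (1 : K) = 0 by rewrite oner_eq0.
have -> : 1 = (ord0 == ord0 :> 'I_r.+1)%:R :> K by [].
apply: (free_e (fun k => (k == ord0)%:R)).
rewrite (bigD1 ord0) //= scale1r big1 ?addr0 // => k /negbTE->.
by rewrite scale0r.
Qed.

(* The socle is one-dimensional and contains the top degree. *)
Lemma gorenstein_socle_free h d :
  has_H_vector I h -> has_dim_mod (in_socle I) I 1 -> (d < (size h).-1)%N ->
  socle_free I d.
Proof.
case=> last_h dim_h dim_socle; set s := (size h).-1 => ds p homp socle_p.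
have [|q homq nIq] := has_dim_mod_neq0 (dim_h s); first by rewrite nth_last.
have socle_q : in_socle I q.
  have h_above : nth 0%N h s.+1 = 0%N by rewrite nth_default // leqSpred.
  move=> k; have := dim_h s.+1; rewrite h_above => /has_dim_mod0.
  by apply; apply: dhomogXM.
pose pq : 'cV_2 := \col_i if i == 0 then p else q.
have [|u u0] := dim_mod_dependent (F := pq) idI dim_socle.
  by move=> i; rewrite mxE; case: ifP.
rewrite /basis_comb !big_ord_recl big_ord0 addr0 !mxE /=.
set a := u 0 _; set b := u 0 _ => Iab.
have part e : I (a *: (p *+ (d == e)) + b *: (q *+ (s == e))).
  have := homog_ideal_zpart e homI Iab; rewrite linearD !linearZ /=.
  by rewrite (zpart_dhomog _ homp) (zpart_dhomog _ homq) !eqz_nat.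
have [a0|a_neq0] := eqVneq a 0; last first.
  have := part d; rewrite eqxx gtn_eqF // mulr0n scaler0 addr0 mulr1n.
  exact: idealZ_inj.
case: nIq; have := part s; rewrite eqxx a0 scale0r add0r mulr1n.
apply: (idealZ_inj idI); apply: contraNneq u0 => b0.
apply/eqP/rowP=> i; rewrite mxE; case: (unliftP ord0 i) => [j|] -> //.
by rewrite (ord1 j).
Qed.

(* Multiplication A_t x A_1 -> A_(t+1) = K is a perfect pairing. *)
Lemma exists_dual_element t :
  has_dim_homog I t n -> has_dim_homog I t.+1 1 -> socle_free I t ->
  forall (k : 'I_n) w, w \is t.+1.-homog ->
  exists u, forall l, I ('X_l * u - w *+ (l == k)).
Proof.
move=> /has_dim_modP[E [homE freeE _]] /has_dim_modP[F [_ _ spanF]] no_socle.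
move=> k w homw; pose s := F 0 0.
have spanS p : p \is t.+1.-homog -> exists c, I (p - c *: s).
  by case/spanF=> c; rewrite /basis_comb big_ord1; exists (c 0 0).
have /fin_all_exists [c cP] (al : 'I_n * 'I_n) :
    exists c, I ('X_al.2 * E al.1 0 - c *: s).
  by apply/spanS/dhomogXM.
pose pairing := \matrix_(a, l) c (a, l).
have mulX_pairing u l : I ('X_l * basis_comb E u - (u *m pairing) 0 l *: s).
  rewrite mxE scaler_suml mulr_sumr -sumrB; apply: (ideal_sum idI) => a _.
  rewrite mxE -scalerAr -scalerA -scalerBr; exact/(idealZ idI)/(cP (a, l)).
have pairing_unit : pairing \in unitmx.
  rewrite -row_free_unit -kermx_eq0; apply/rowV0P=> u /sub_kermxP u_pairing.
  apply/freeE/no_socle => [|l]; first exact: basis_comb_homog.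
  by have := mulX_pairing u l; rewrite u_pairing mxE scale0r subr0.
have [b wb] := spanS w homw.
exists (basis_comb E (b *: delta_mx 0 k *m invmx pairing)) => l.
have := mulX_pairing (b *: delta_mx 0 k *m invmx pairing) l.
rewrite mulmxKV // !mxE eqxx /=.
case: (l == k); last by rewrite mulr0 scale0r mulr0n.
rewrite mulr1 mulr1n => Iu; have := idealB idI Iu wb.
by rewrite opprB addrA subrK.
Qed.

Lemma koszul_acyclic_middle s r i d : (r < s)%N -> (1 < d)%N -> (d.+1 < s)%N ->
  (forall e, (0 < e)%N -> (e < s)%N -> has_dim_homog I e r) ->
  (forall e, (e < s)%N -> socle_free I e) ->
  koszul_acyclic I i d.
Proof.
move=> rs d_gt1 ds dim_r no_socle.
have [||l homl injl] := @exists_injective_linear_form n K I charK idI 1 r.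
- by apply: dim_r => //; lia.
- by move=> j jr; apply: no_socle; lia.
have surjl e : mul_surj_on I l e.+1 e.+2.
  elim: e => [|e]; last exact: mul_surj_onS.
  by apply: (mul_inj_surj idI homl (dim_r 1%N _ _) (dim_r 2%N _ _) injl); lia.
case: d d_gt1 ds => [|[|d]] // _ ds.
apply: (koszul_acyclic_bij idI charK homl) => //.
by apply: (mul_surj_inj idI homl (dim_r d.+2 _ _) (dim_r d.+3 _ _)) => //; lia.
Qed.

End SocleAndDuality.

(** * Betti numbers for the H-vector (1, n, ..., n, 1) *)

Definition flat_hvector (n s : nat) : seq nat := (1 :: rcons (nseq s.-1 n) 1)%N.

(* Row j - i = 1 has the ranks of the Eagon-Northcott complex of a 2 x n matrix,
   and row s - 1 those of its dual. *)
Definition flat_betti (n s i : nat) (j : int) : nat :=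
  (((i == 0) && (j == 0%Z)) + i * 'C(n, i.+1) * (j == i.+1) +
   (n - i) * 'C(n, (n - i).+1) * (j == (i + s.-1)%N) +
   ((i == n) && (j == (n + s)%N)))%N.

Lemma flat_betti_low n s i (j : int) :
  (forall d : nat, j <> (i + d)%N%:Z) -> flat_betti n s i j = 0%N.
Proof.
move=> j_low; have jE (d : nat) : (j == (i + d)%N) = false by apply/eqP/j_low.
rewrite /flat_betti -(addn1 i) (jE 1%N) (jE s.-1) !muln0 !addn0.
by have := jE 0%N; have := jE s; lia.
Qed.

Lemma nth_flat_hvector n s d : (0 < s)%N ->
  nth 0%N (flat_hvector n s) d =
  (if d == 0 then 1 else if d < s then n else d == s)%N.
Proof.
case: s => // s _; case: d => //= d.
rewrite nth_rcons size_nseq nth_nseq ltnS eqSS.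
by case: ltnP => // _; case: eqP.
Qed.

Lemma bin_pred n i : (0 < n)%N ->
  ('C(n, i.+1) = 'C(n.-1, i.+1) + 'C(n.-1, i))%N.
Proof. by case: n => // n _; rewrite binS. Qed.

Section StrandArithmetic.
Variables (n s : nat) (b rho : nat -> nat -> nat).
Hypotheses (n_lt_s : (n < s)%N) (s_gt2 : (2 < s)%N).
Hypothesis rho0 : forall d, rho 0%N d = 0%N.
Hypothesis strand : forall i d,
  (b i d + (if d is d'.+1 then rho i.+1 d' else 0) + rho i d =
   'C(n, i) * nth 0 (flat_hvector n s) d)%N.
Hypothesis b_degree0 : forall i, b i.+1 0%N = 0%N.
Hypothesis b_middle : forall i d, (1 < d)%N -> (d.+1 < s)%N -> b i d = 0%N.
Hypothesis b_top : forall i, (i < n)%N -> b i s = 0%N.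
Hypothesis b_hd0 : forall d, b 0%N d.+1 = 0%N.
Hypothesis b_hd_max : forall d, (d < s)%N -> b n d = 0%N.

Let n_gt0 : (0 < n)%N.
Proof.
by case: n b_hd_max (strand 0 0) => // /(_ 0%N) ->; rewrite ?rho0 //; lia.
Qed.

Lemma rank_degree0 i : rho i.+1 0%N = 'C(n, i.+1).
Proof. by have := strand i.+1 0; rewrite b_degree0 muln1. Qed.

Lemma strand_flat i d : (d.+1 < s)%N ->
  (b i d.+1 + rho i.+1 d + rho i d.+1 = 'C(n, i) * n)%N.
Proof. by move=> ds; rewrite strand nth_flat_hvector ?ds //; lia. Qed.

Lemma rank_hd_gt i d : (n < i)%N -> rho i d = 0%N.
Proof. by move=> ni; have := strand i d; rewrite bin_small //; lia. Qed.

Lemma strand_above i d : (s <= d)%N -> (b i d.+1 + rho i.+1 d = 0)%N.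
Proof.
move=> sd; have := strand i d.+1.
rewrite nth_default ?muln0; last by rewrite /= size_rcons size_nseq; lia.
by lia.
Qed.

Lemma strand_top i : (b i s + rho i.+1 s.-1 = 'C(n, i))%N.
Proof.
have : (b i s + rho i.+1 s.-1 + rho i s = 'C(n, i))%N.
  transitivity ('C(n, i) * nth 0 (flat_hvector n s) s)%N.
    by rewrite -strand; case: s s_gt2.
  by rewrite nth_flat_hvector ?ltnn ?eqxx ?gtn_eqF ?muln1 //; lia.
have -> : rho i s = 0%N; last by lia.
by case: i => // i; have := strand_above i (leqnn s); lia.
Qed.

Definition rank_flat_at i d : Prop := rho i.+1 d = (n * 'C(n.-1, i))%N.

Lemma rank_flat_antidiagonal i d : (0 < d)%N -> (d.+2 < s)%N ->
  rank_flat_at i.+1 d <-> rank_flat_at i d.+1.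
Proof.
move=> d_gt0 ds; have := @strand_flat i.+1 d; rewrite b_middle // /rank_flat_at.
by rewrite (bin_pred i n_gt0); lia.
Qed.

Lemma rank_flat_hd1 d : (d.+1 < s)%N -> rank_flat_at 0 d.
Proof.
move=> /(strand_flat 0); rewrite b_hd0 rho0 /rank_flat_at !bin0; lia.
Qed.

Lemma rank_flat_hd_max i d : (0 < d)%N -> (d.+1 < s)%N -> (n.-1 <= i)%N ->
  rank_flat_at i d.
Proof.
rewrite /rank_flat_at => d_gt0 ds; rewrite leq_eqVlt => /predU1P[<-|ni].
  have := @strand_flat n d.-1; rewrite !prednK // b_hd_max; last by lia.
  by rewrite rank_hd_gt // !binn; lia.
by rewrite rank_hd_gt ?bin_small //; lia.
Qed.

(* Every antidiagonal i + d = e reaches i = 0 or i = n - 1, since n < s. *)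
Lemma rank_flat i d : (0 < d)%N -> (d.+1 < s)%N ->
  rho i.+1 d = (n * 'C(n.-1, i))%N.
Proof.
have from_hd1 : forall i d, (0 < d)%N -> (i + d.+1 < s)%N -> rank_flat_at i d.
  elim=> [|j IHj] e e_gt0 es; first exact: rank_flat_hd1.
  by apply/rank_flat_antidiagonal; [|lia|apply: IHj; lia].
have from_hd_max : forall d i, (0 < d)%N -> (d.+1 < s)%N -> (n <= i + d)%N ->
    rank_flat_at i d.
  elim=> // e IHe j _ es nje.
  have [nj|jn] := leqP n.-1 j; first exact: rank_flat_hd_max.
  by apply/rank_flat_antidiagonal; [lia|lia|apply: IHe; lia].
move=> d_gt0 ds; have [id_s|id_s] := ltnP (i + d.+1) s; first exact: from_hd1.
by apply: from_hd_max => //; lia.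
Qed.

Lemma rank_top i : (i < n)%N -> rho i.+1 s.-1 = 'C(n, i).
Proof. by move=> i_n; have := strand_top i; rewrite b_top. Qed.

Lemma betti_degree1 i : b i 1%N = (i * 'C(n, i.+1))%N.
Proof.
case: i => [|i]; first by rewrite b_hd0.
have := @strand_flat i.+1 0.
rewrite rank_degree0 rank_flat // (bin_pred i n_gt0).
have := mul_bin_diag n i.+1; lia.
Qed.

Lemma betti_subtop i : b i s.-1 = ((n - i) * 'C(n, (n - i).+1))%N.
Proof.
have := @strand_flat i s.-2; rewrite !prednK; try lia.
case: i => [|i].
  by rewrite rank_flat ?bin0 ?subn0 ?[in X in _ -> X]bin_small; lia.
have [ni|i_n] := leqP n i.
  by rewrite bin_small // (_ : n - i.+1 = 0)%N; lia.
rewrite rank_flat ?rank_top ?(bin_pred i n_gt0); try lia.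
rewrite subnSK // bin_sub; last by lia.
have -> : (n - i.+1 = (n - i).-1)%N by lia.
by have := mul_bin_down n i; case: (n - i)%N; lia.
Qed.

Lemma betti_degree0 i : b i 0%N = (i == 0)%N.
Proof.
case: i => [|i]; last exact: b_degree0.
by have := strand 0 0; rewrite rho0 bin0 /=; lia.
Qed.

Lemma betti_top i : b i s = (i == n).
Proof.
have := strand_top i; case: (ltngtP i n) => [/b_top-> //|n_i|->].
  by rewrite bin_small //; lia.
by rewrite rank_hd_gt // binn; lia.
Qed.

Lemma betti_flat i d : b i d = flat_betti n s i (i + d)%N.
Proof.
have d_eq1 : (i + d == i.+1)%N = (d == 1)%N by lia.
rewrite /flat_betti !eqz_nat d_eq1 eqn_add2l.
have [->|d1] := eqVneq d 1%N.
  rewrite betti_degree1 (_ : (1 == s.-1)%N = false) ?muln0 ?muln1; lia.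
have [->|d2] := eqVneq d s.-1.
  rewrite betti_subtop muln0 muln1; lia.
rewrite !muln0 !addn0; have [->|d0] := eqVneq d 0%N.
  rewrite betti_degree0; lia.
have [ds|sd|->] := ltngtP d s; last by rewrite betti_top; lia.
  by rewrite b_middle; lia.
by have := strand_above i (_ : s <= d.-1)%N; rewrite prednK; lia.
Qed.

End StrandArithmetic.

Section FlatGorenstein.
Variables (n s : nat) (K : fieldType) (I : {mpoly K[n]} -> Prop).
Hypotheses (n_lt_s : (n < s)%N) (s_gt2 : (2 < s)%N).
Hypothesis charK : [pchar K] =i pred0.
Hypothesis homI : is_homog_ideal I.
Hypothesis no_linear : forall l, l \is 1.-homog -> I l -> l = 0.
Hypothesis dim_socle : has_dim_mod (in_socle I) I 1.
Hypothesis hvecI : has_H_vector I (flat_hvector n s).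

Let idI : is_ideal I := homI.1.

Lemma flat_dim e : (0 < e)%N -> (e < s)%N -> has_dim_homog I e n.
Proof.
move=> e_gt0 es; have := hvecI.2 e; rewrite /has_dim_homog.
by rewrite nth_flat_hvector ?es ?gtn_eqF //; lia.
Qed.

Lemma flat_socle_free e : (e < s)%N -> socle_free I e.
Proof.
move=> es; apply: (gorenstein_socle_free homI hvecI dim_socle).
by rewrite /= size_rcons size_nseq; lia.
Qed.

Lemma flat_dual_element (k : 'I_n) w : w \is s.-homog ->
  exists u, forall l, I ('X_l * u - w *+ (l == k)).
Proof.
case: s s_gt2 flat_dim flat_socle_free hvecI => // t t_gt1 dim_t socle_t.
case=> _ /(_ t.+1); rewrite nth_flat_hvector // ltnn eqxx /= => dim_top.
by apply: exists_dual_element => //; [apply: dim_t; lia | apply: socle_t].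
Qed.

Theorem has_graded_betti_flat : has_graded_betti I (flat_betti n s).
Proof.
have [exF [rho rho0 bettiF]] := koszul_betti charK homI hvecI.
split=> // F minF i j; have [strand betti_low acyclic] := bettiF F minF.
have [[d ->]|j_low] := classic (exists d : nat, j = (i + d)%N); last first.
  by rewrite betti_low ?flat_betti_low // => d jd; apply: j_low; exists d.
apply: (@betti_flat n s (fun i d => gf_betti F i (i + d)%N) rho) => //.
- by move=> k; apply/acyclic/koszul_acyclic_degree0.
- move=> k e e_gt1 es; apply/acyclic.
  apply: (koszul_acyclic_middle charK homI n_lt_s) => //.
    exact: flat_dim.
  exact: flat_socle_free.
- by move=> k kn; apply/acyclic/koszul_acyclic_dual/flat_dual_element.
- by move=> e; apply/acyclic/koszul_acyclic_hd0.
- by move=> e es; apply/acyclic/koszul_acyclic_hd_max/flat_socle_free.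
Qed.

End FlatGorenstein.

Theorem theorem3p4 (K : fieldType) (charK : [pchar K] =i pred0)
    (I : {mpoly K[4]} -> Prop)
    (homI : is_homog_ideal I)
    (nolinI : forall l : {mpoly K[4]}, l \is 1.-homog -> I l -> l = 0)
    (gorI : quotient_artinian_gorenstein I)
    (HvecI : has_H_vector I [:: 1; 4; 4; 4; 4; 1]%N) :
  has_graded_betti I
    (betti_table
      [:: (0%N, 0%Z, 1%N); (1%N, 2%Z, 6%N); (2%N, 3%Z, 8%N); (3%N, 4%Z, 3%N);
          (1%N, 5%Z, 3%N); (2%N, 6%Z, 8%N); (3%N, 7%Z, 6%N); (4%N, 9%Z, 1%N)]).
Proof.
have [exF bettiF] : has_graded_betti I (flat_betti 4 5).
  by apply: has_graded_betti_flat => //; case: gorI.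
split=> // F /bettiF betti i j.
rewrite betti /flat_betti /betti_table unlock /=.
case: i => [|[|[|[|[|i]]]]] /=; last by rewrite bin_small // muln0.
all: by rewrite !xpair_eqE !(eq_sym j) /=; do ?case: eqP => //; lia.
Qed.
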